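(* Let $m\geq 1$ be an integer, and let $R\subseteq B_3[m]$ be a subset such that the normal closure of $\bar\rho_3(R)$ in $\mathrm{SL}_2(\mathbb{Z})$ contains $\mathrm{SL}_2(\mathbb{Z})[2m]$. Then, for $n=3$ and for $n=4$, the level $m$ congruence subgroup $B_n[m]$ is normally generated in $B_n$ (i.e. is equal to the normal closure in $B_n$) by $R$, $\sigma_1^m$ and $(\sigma_1\sigma_2)^6$.
   Context: $B_n$ is the braid group on $n$ strands with standard generators $\sigma_1,\ldots,\sigma_{n-1}$ (relations $\sigma_i\sigma_{i+1}\sigma_i=\sigma_{i+1}\sigma_i\sigma_{i+1}$, and $\sigma_i\sigma_j=\sigma_j\sigma_i$ for $|i-j|\geq 2$). For $n=4$, $R$ is regarded as a subset of $B_4$ via the standard inclusion $B_3\to B_4$, $\sigma_i\mapsto\sigma_i$. The integral Burau representation is the homomorphism $\rho_n\colon B_n\to \mathrm{GL}_n(\mathbb{Z})$ given by $\sigma_i\mapsto I_{i-1}\oplus\begin{pmatrix}2&1\\-1&0\end{pmatrix}\oplus I_{n-i-1}$ for $1\leq i<n$ (the unreduced Burau representation $\sigma_i\mapsto I_{i-1}\oplus\begin{pmatrix}1-t&1\\t&0\end{pmatrix}\oplus I_{n-i-1}$ specialized at $t=-1$), where $I_j$ is the $j\times j$ identity matrix. The level $m$ congruence subgroup is $B_n[m]:=\ker\bigl(B_n\xrightarrow{\rho_n}\mathrm{GL}_n(\mathbb{Z})\to \mathrm{GL}_n(\mathbb{Z}/m\mathbb{Z})\bigr)$, where the second map is reduction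 mod $m$. $\bar\rho_3\colon B_3\to \mathrm{SL}_2(\mathbb{Z})$ is the surjective homomorphism with $\sigma_1\mapsto\begin{pmatrix}1&1\\0&1\end{pmatrix}$ and $\sigma_2\mapsto\begin{pmatrix}1&0\\-1&1\end{pmatrix}$. For $k\geq 1$, $\mathrm{SL}_2(\mathbb{Z})[k]$ denotes the principal level $k$ congruence subgroup, i.e. the kernel of $\mathrm{SL}_2(\mathbb{Z})\to \mathrm{SL}_2(\mathbb{Z}/k\mathbb{Z})$. *)

(* Defs.v *)
From HB Require Import structures.
From mathcomp Require Import all_boot all_order all_algebra.
From mathcomp Require Import zify ring generic_quotient boolp classical_sets.

Set Implicit Arguments.
Unset Strict Implicit.
Unset Printing Implicit Defensive.

Import GRing.Theory.

Local Open Scope classical_set_scope.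
Local Open Scope quotient_scope.
Local Open Scope group_scope.

Section NormalClosure.
Variable G : groupType.

Definition normal_subgroup (N : set G) : Prop :=
  [/\ N 1,
      forall x y, N x -> N y -> N (x * y),
      forall x, N x -> N x^-1
    & forall x g, N x -> N (x ^ g)].

Definition normal_closure (S : set G) : set G :=
  \bigcap_(N in [set N | normal_subgroup N /\ S `<=` N]) N.

End NormalClosure.

(* Strands and generators are numbered from 0: [i : 'I_n.-1] stands for the
   generator sigma_(i+1). The letter [(i, false)] is sigma_(i+1) and
   [(i, true)] is its inverse. *)
Definition braid_word (n : nat) := seq ('I_n.-1 * bool).

Inductive braid_eq (n : nat) : braid_word n -> braid_word n -> Prop :=
| braid_eq_refl w : braid_eq w w
| braid_eq_sym w1 w2 : braid_eq w1 w2 -> braid_eq w2 w1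
| braid_eq_trans w1 w2 w3 :
    braid_eq w1 w2 -> braid_eq w2 w3 -> braid_eq w1 w3
| braid_eq_cat w1 w2 w1' w2' :
    braid_eq w1 w1' -> braid_eq w2 w2' -> braid_eq (w1 ++ w2) (w1' ++ w2')
| braid_eq_cancel i b : braid_eq [:: (i, b); (i, ~~ b)] [::]
| braid_eq_far (i j : 'I_n.-1) : i.+2 <= j ->
    braid_eq [:: (i, false); (j, false)] [:: (j, false); (i, false)]
| braid_eq_adj (i j : 'I_n.-1) : j = i.+1 :> nat ->
    braid_eq [:: (i, false); (j, false); (i, false)]
             [:: (j, false); (i, false); (j, false)].

Section BraidGroup.
Variable n : nat.

Definition braid_eqb : rel (braid_word n) := fun v w => `[< braid_eq v w >].

Lemma braid_eqb_equiv : equiv_class_of braid_eqb.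
Proof.
split.
- by move=> w; apply/asboolP; exact: braid_eq_refl.
- by move=> v w; apply/asboolP/asboolP; exact: braid_eq_sym.
- move=> v u w /asboolP uv /asboolP vw; apply/asboolP.
  exact: braid_eq_trans uv vw.
Qed.

Canonical braid_equiv := EquivRelPack braid_eqb_equiv.

Definition braid := {eq_quot braid_equiv}.

HB.instance Definition _ := Choice.on braid.
HB.instance Definition _ := EqQuotient.on braid.

Definition braid_of_word (w : braid_word n) : braid := \pi w.

Definition braid_word_inv (w : braid_word n) : braid_word n :=
  rev [seq (l.1, ~~ l.2) | l <- w].

Lemma braid_of_wordP v w :
  (braid_of_word v = braid_of_word w) <-> braid_eq v w.
Proof.
split; first by move/eqmodP/asboolP.
by move=> vw; apply/eqmodP/asboolP.
Qed.

Lemma braid_of_word_repr (x : braid) : braid_of_word (repr x) = x.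
Proof. exact: reprK. Qed.

Lemma braid_eq_repr w : braid_eq (repr (braid_of_word w)) w.
Proof. by apply/braid_of_wordP; rewrite braid_of_word_repr. Qed.

Definition braid_mul (x y : braid) : braid := braid_of_word (repr x ++ repr y).
Definition braid_one : braid := braid_of_word [::].
Definition braid_inv (x : braid) : braid :=
  braid_of_word (braid_word_inv (repr x)).

Lemma braid_mulA : associative braid_mul.
Proof.
move=> x y z; apply/braid_of_wordP.
apply: (@braid_eq_trans _ _ (repr x ++ repr y ++ repr z)).
  by apply: braid_eq_cat (braid_eq_repr _); exact: braid_eq_refl.
rewrite catA; apply: braid_eq_cat (braid_eq_refl _).
exact/braid_eq_sym/braid_eq_repr.
Qed.

Lemma braid_mul1 : left_id braid_one braid_mul.
Proof.
move=> x; rewrite -[RHS]braid_of_word_repr; apply/braid_of_wordP.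
exact: braid_eq_cat (braid_eq_repr _) (braid_eq_refl _).
Qed.

Lemma braid_mulr1 : right_id braid_one braid_mul.
Proof.
move=> x; rewrite -[RHS]braid_of_word_repr; apply/braid_of_wordP.
rewrite -[X in braid_eq _ X]cats0.
exact: braid_eq_cat (braid_eq_refl _) (braid_eq_repr _).
Qed.

Lemma braid_word_invK : involutive braid_word_inv.
Proof.
move=> w; rewrite /braid_word_inv map_rev revK -map_comp.
by rewrite -[RHS]map_id; apply: eq_map => -[i b] /=; rewrite negbK.
Qed.

Lemma braid_eq_mulV w : braid_eq (w ++ braid_word_inv w) [::].
Proof.
elim: w => [|[i b] w IHw]; first exact: braid_eq_refl.
rewrite /braid_word_inv /= rev_cons -cats1.
apply: (@braid_eq_trans _ _ ([:: (i, b)] ++ [::] ++ [:: (i, ~~ b)])).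
  apply: (@braid_eq_cat _ [:: (i, b)]) (braid_eq_refl _) _.
  by rewrite catA; apply: braid_eq_cat IHw (braid_eq_refl _).
exact: braid_eq_cancel.
Qed.

Lemma braid_eq_Vmul w : braid_eq (braid_word_inv w ++ w) [::].
Proof. by rewrite -{2}(braid_word_invK w); exact: braid_eq_mulV. Qed.

Lemma braid_mulVx : left_inverse braid_one braid_inv braid_mul.
Proof.
move=> x; apply/braid_of_wordP; apply: braid_eq_trans (braid_eq_Vmul (repr x)).
exact: braid_eq_cat (braid_eq_repr _) (braid_eq_refl _).
Qed.

Lemma braid_mulxV : right_inverse braid_one braid_inv braid_mul.
Proof.
move=> x; apply/braid_of_wordP; apply: braid_eq_trans (braid_eq_mulV (repr x)).
exact: braid_eq_cat (braid_eq_refl _) (braid_eq_repr _).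
Qed.

HB.instance Definition _ := isGroup.Build braid
  braid_mulA braid_mul1 braid_mulr1 braid_mulVx braid_mulxV.

Definition sigma (i : 'I_n.-1) : braid := braid_of_word [:: (i, false)].

Lemma braid_of_word_cat v w :
  braid_of_word (v ++ w) = braid_of_word v * braid_of_word w.
Proof.
apply/braid_of_wordP/braid_eq_sym.
exact: braid_eq_cat (braid_eq_repr _) (braid_eq_repr _).
Qed.

Lemma braid_of_word_letter i b :
  braid_of_word [:: (i, b)] = if b then (sigma i)^-1 else sigma i.
Proof.
case: b => //; apply/esym/mulg1_eq; rewrite -braid_of_word_cat.
exact/braid_of_wordP/braid_eq_cancel.
Qed.

Lemma sigma_far (i j : 'I_n.-1) : i.+2 <= j ->
  sigma i * sigma j = sigma j * sigma i.
Proof.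
by move=> ij; rewrite -!braid_of_word_cat; apply/braid_of_wordP/braid_eq_far.
Qed.

Lemma sigma_adj (i j : 'I_n.-1) : j = i.+1 :> nat ->
  sigma i * sigma j * sigma i = sigma j * sigma i * sigma j.
Proof.
move=> ij; rewrite -(braid_of_word_cat [:: (i, false)] [:: (j, false)]).
rewrite -(braid_of_word_cat [:: (j, false)] [:: (i, false)]).
by rewrite -!braid_of_word_cat; apply/braid_of_wordP/braid_eq_adj.
Qed.

(* The homomorphism with [sigma i |-> f i]; it is only meaningful when [f]
   satisfies [braid_relations]. *)
Variables (H : groupType) (f : 'I_n.-1 -> H).

Definition braid_relations : Prop :=
  (forall i j : 'I_n.-1, i.+2 <= j -> f i * f j = f j * f i) /\
  (forall i j : 'I_n.-1, j = i.+1 :> nat ->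
     f i * f j * f i = f j * f i * f j).

Definition word_eval (w : braid_word n) : H :=
  \prod_(l <- w) (if l.2 then (f l.1)^-1 else f l.1).

Definition braid_lift (x : braid) : H := word_eval (repr x).

Hypothesis frel : braid_relations.

Lemma word_eval_eq v w : braid_eq v w -> word_eval v = word_eval w.
Proof.
rewrite /word_eval; elim=> {v w} //.
- by move=> u v w _ -> _ ->.
- by move=> ? ? ? ? _ IHu _ IHv; rewrite !big_cat /= IHu IHv.
- move=> i b; rewrite !big_cons big_nil mulg1 /=.
  by case: b; rewrite /= ?mulVg ?mulgV.
- by move=> i j ij; rewrite !big_cons !big_nil /= !mulg1; apply: frel.1.
- by move=> i j ij; rewrite !big_cons !big_nil /= !mulg1 !mulgA; apply: frel.2.
Qed.

Lemma braid_lift_word w : braid_lift (braid_of_word w) = word_eval w.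
Proof. exact/word_eval_eq/braid_eq_repr. Qed.

Lemma braid_lift_sigma i : braid_lift (sigma i) = f i.
Proof. by rewrite braid_lift_word /word_eval big_cons big_nil mulg1. Qed.

Lemma braid_lift_umagma : monoid.monoid_morphism braid_lift.
Proof.
split; first by rewrite braid_lift_word /word_eval big_nil.
by move=> x y; rewrite braid_lift_word /word_eval big_cat.
Qed.

End BraidGroup.

Definition sigma1 {n : nat} : braid n.+2 := @sigma n.+2 (@Ordinal n.+1 0 isT).
Definition sigma2 {n : nat} : braid n.+3 := @sigma n.+3 (@Ordinal n.+2 1 isT).

Section Inclusion.
Variable n : nat.

Definition braid_incl_gen (i : 'I_n.-1) : braid n.+1 :=
  @sigma n.+1 (widen_ord (leq_pred n) i).

Definition braid_incl : braid n -> braid n.+1 := braid_lift braid_incl_gen.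

Lemma braid_incl_relations : braid_relations braid_incl_gen.
Proof. by split=> i j ij; [exact: sigma_far | exact: sigma_adj]. Qed.

HB.instance Definition _ := isUMagmaMorphism.Build _ _ braid_incl
  (braid_lift_umagma braid_incl_relations).

Lemma braid_incl_sigma i :
  braid_incl (sigma i) = @sigma n.+1 (widen_ord (leq_pred n) i).
Proof. exact: (braid_lift_sigma braid_incl_relations). Qed.

End Inclusion.

Local Open Scope ring_scope.

Section MatrixGroups.
Variable n : nat.

Definition GLZ := {A : 'M[int]_n | A \in unitmx}.
HB.instance Definition _ := SubChoice.on GLZ.

Definition mkGLZ (A : 'M[int]_n) (uA : A \in unitmx) : GLZ :=
  exist (fun A => is_true (A \in unitmx)) A uA.

Lemma GLZ_mul_subproof (A B : GLZ) : val A *m val B \in unitmx.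
Proof. by rewrite unitmx_mul (valP A) (valP B). Qed.
Lemma GLZ_inv_subproof (A : GLZ) : invmx (val A) \in unitmx.
Proof. by rewrite unitmx_inv (valP A). Qed.

Definition GLZ_mul (A B : GLZ) : GLZ := mkGLZ (GLZ_mul_subproof A B).
Definition GLZ_one : GLZ := mkGLZ (unitmx1 int n).
Definition GLZ_inv (A : GLZ) : GLZ := mkGLZ (GLZ_inv_subproof A).

Lemma GLZ_mulA : associative GLZ_mul.
Proof. by move=> A B C; apply: val_inj; rewrite /= mulmxA. Qed.
Lemma GLZ_mul1 : left_id GLZ_one GLZ_mul.
Proof. by move=> A; apply: val_inj; rewrite /= mul1mx. Qed.
Lemma GLZ_mulr1 : right_id GLZ_one GLZ_mul.
Proof. by move=> A; apply: val_inj; rewrite /= mulmx1. Qed.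
Lemma GLZ_mulVx : left_inverse GLZ_one GLZ_inv GLZ_mul.
Proof. by move=> A; apply: val_inj; rewrite /= mulVmx // (valP A). Qed.
Lemma GLZ_mulxV : right_inverse GLZ_one GLZ_inv GLZ_mul.
Proof. by move=> A; apply: val_inj; rewrite /= mulmxV // (valP A). Qed.

HB.instance Definition _ := isGroup.Build GLZ
  GLZ_mulA GLZ_mul1 GLZ_mulr1 GLZ_mulVx GLZ_mulxV.

Definition SLZ := {A : 'M[int]_n | (\det A == 1)%R}.
HB.instance Definition _ := SubChoice.on SLZ.

Definition mkSLZ (A : 'M[int]_n) (dA : (\det A == 1)%R) : SLZ :=
  exist (fun A => is_true (\det A == 1)%R) A dA.

Lemma SLZ_unitmx (A : SLZ) : val A \in unitmx.
Proof. by rewrite unitmxE (eqP (valP A)) unitr1. Qed.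

Lemma SLZ_mul_subproof (A B : SLZ) : (\det (val A *m val B) == 1)%R.
Proof. by rewrite det_mulmx (eqP (valP A)) (eqP (valP B)) mulr1. Qed.
Lemma SLZ_one_subproof : (\det (1%:M : 'M[int]_n) == 1)%R.
Proof. by rewrite det1. Qed.
Lemma SLZ_inv_subproof (A : SLZ) : (\det (invmx (val A)) == 1)%R.
Proof. by rewrite det_inv (eqP (valP A)) invr1. Qed.

Definition SLZ_mul (A B : SLZ) : SLZ := mkSLZ (SLZ_mul_subproof A B).
Definition SLZ_one : SLZ := mkSLZ SLZ_one_subproof.
Definition SLZ_inv (A : SLZ) : SLZ := mkSLZ (SLZ_inv_subproof A).

Lemma SLZ_mulA : associative SLZ_mul.
Proof. by move=> A B C; apply: val_inj; rewrite /= mulmxA. Qed.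
Lemma SLZ_mul1 : left_id SLZ_one SLZ_mul.
Proof. by move=> A; apply: val_inj; rewrite /= mul1mx. Qed.
Lemma SLZ_mulr1 : right_id SLZ_one SLZ_mul.
Proof. by move=> A; apply: val_inj; rewrite /= mulmx1. Qed.
Lemma SLZ_mulVx : left_inverse SLZ_one SLZ_inv SLZ_mul.
Proof. by move=> A; apply: val_inj; rewrite /= mulVmx // SLZ_unitmx. Qed.
Lemma SLZ_mulxV : right_inverse SLZ_one SLZ_inv SLZ_mul.
Proof. by move=> A; apply: val_inj; rewrite /= mulmxV // SLZ_unitmx. Qed.

HB.instance Definition _ := isGroup.Build SLZ
  SLZ_mulA SLZ_mul1 SLZ_mulr1 SLZ_mulVx SLZ_mulxV.

(* Equality of the reductions mod [m]. Stated entrywise because the type 'Z_1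
   is Z/2Z, not the zero ring. *)
Definition eqmx_mod (m : nat) (A B : 'M[int]_n) : Prop :=
  forall i j, (A i j = B i j %[mod m%:Z])%Z.

Definition SLZ_congruence (k : nat) : set SLZ :=
  [set A | eqmx_mod k (val A) 1%:M].

End MatrixGroups.

Arguments SLZ_congruence n k : clear implicits.

Definition mx2 (a b c d : int) : 'M[int]_2 :=
  \matrix_(i < 2, j < 2) nth 0 (nth [::] [:: [:: a; b]; [:: c; d]] i) j.

Section Burau.
Variable n : nat.

(* The block sum I_i (+) (2, 1; -1, 0) (+) I_(n-i-2), entrywise. *)
Definition burau_mx (i : nat) : 'M[int]_n :=
  \matrix_(j < n, k < n)
    if ((i <= j <= i.+1) && (i <= k <= i.+1))%N
    then mx2 2 1 (- 1) 0 (inord (j - i)) (inord (k - i))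
    else (j == k)%:R.

Lemma burau_ltnS (i : 'I_n.-1) : (i.+1 < n)%N.
Proof. by case: i; case: n. Qed.

Let o0 (i : 'I_n.-1) : 'I_n := Ordinal (ltnW (burau_ltnS i)).
Let o1 (i : 'I_n.-1) : 'I_n := Ordinal (burau_ltnS i).
Let u (i : 'I_n.-1) : 'cV[int]_n := delta_mx (o0 i) 0 - delta_mx (o1 i) 0.
Let v (i : 'I_n.-1) : 'rV[int]_n := delta_mx 0 (o0 i) + delta_mx 0 (o1 i).
Let a (i : 'I_n.-1) : 'M[int]_n := u i *m v i.

Lemma burau_mxE (i : 'I_n.-1) : burau_mx i = 1%:M + a i.
Proof.
apply/matrixP => j k; rewrite /a /u /v mulmxBl !mulmxDr !mul_delta_mx !mxE.
have e0 (l : 'I_n) : (l == o0 i) = (l == i :> nat) by [].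
have e1 (l : 'I_n) : (l == o1 i) = (l == i.+1 :> nat) by [].
have cl (l : nat) : [\/ l = i :> nat, l = i.+1 :> nat
    | [/\ (i <= l <= i.+1)%N = false, (l == i :> nat) = false
        & (l == i.+1 :> nat) = false]].
  case: (eqVneq l i) => [|li]; first by constructor 1.
  case: (eqVneq l i.+1) => [|lSi]; first by constructor 2.
  by constructor 3; split=> //; lia.
rewrite !e0 !e1 -(inj_eq val_inj) /=.
have I0 : inord (i - i) = 0 :> 'I_2 by rewrite subnn; apply/val_inj/inordK.
have I1 : inord (i.+1 - i) = 1 :> 'I_2 by rewrite subSnn; apply/val_inj/inordK.
have nS : (i == i.+1 :> nat) = false by rewrite ltn_eqF.
have Sn : (i.+1 == i :> nat) = false by rewrite gtn_eqF.
case: (cl j) => [-> | -> | [-> -> ->]]; last by case: (j == k :> nat).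
- case: (cl k) => [-> | -> | [k1 k2 k3]]; rewrite ?k1 ?k2 ?k3 ?leqnn ?leqnSn.
  + by rewrite ?nS ?Sn ?eqxx ?andbF ?I0 ?I1.
  + by rewrite ?nS ?Sn ?eqxx ?andbF ?I0 ?I1.
  + by rewrite ?nS ?Sn ?eqxx ?andbF; case: (i == k :> nat).
- case: (cl k) => [-> | -> | [k1 k2 k3]]; rewrite ?k1 ?k2 ?k3 ?leqnn ?leqnSn.
  + by rewrite ?nS ?Sn ?eqxx ?andbF ?I0 ?I1.
  + by rewrite ?nS ?Sn ?eqxx ?andbF ?I0 ?I1.
  + by rewrite ?nS ?Sn ?eqxx ?andbF; case: (i.+1 == k :> nat).
Qed.

Let c (i j : nat) : int := (i.+1 == j)%:R - (i == j.+1)%:R.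

Let dotE (i j : 'I_n.-1) : v i *m u j = (c i j)%:M.
Proof.
rewrite /v /u mulmxDl !mulmxBr !mul_delta_mx_cond -!(inj_eq val_inj) /= /c.
apply/matrixP => p q; rewrite eqSS !ord1 !mxE !mulrb.
case: (i == j :> nat); case: (i == j.+1 :> nat); case: (i.+1 == j :> nat);
  by rewrite ?mxE.
Qed.

Let a_mul (i j : 'I_n.-1) : a i *m a j = c i j *: (u i *m v j).
Proof.
by rewrite /a mulmxA -(mulmxA (u i)) dotE mul_mx_scalar -scalemxAl.
Qed.

Let a_mul3 (i j k : 'I_n.-1) :
  a i *m a j *m a k = (c i j * c j k) *: (u i *m v k).
Proof.
rewrite a_mul /a -scalemxAl mulmxA -(mulmxA (u i)) dotE mul_mx_scalar.
by rewrite -scalemxAl scalerA.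
Qed.

Let a_sqr (i : 'I_n.-1) : a i *m a i = 0.
Proof.
by rewrite a_mul (_ : c i i = 0) ?scale0r // /c gtn_eqF // ltn_eqF.
Qed.

Lemma burau_unitmx (i : 'I_n.-1) : burau_mx i \in unitmx.
Proof.
have: burau_mx i *m (1%:M - a i) = 1%:M.
  by rewrite burau_mxE mulmxDl !mulmxBr a_sqr !(mul1mx, mulmx1) subr0 subrK.
by case/mulmx1_unit.
Qed.

Definition burau_gen (i : 'I_n.-1) : GLZ n := mkGLZ (burau_unitmx i).

Lemma burau_relations : braid_relations burau_gen.
Proof.
split=> i j ij; apply: val_inj; rewrite /= !burau_mxE.
  have cij : c i j = 0 by rewrite /c; lia.
  have cji : c j i = 0 by rewrite /c; lia.
  rewrite !(mulmxDl, mulmxDr, mul1mx, mulmx1) !a_mul cij cji !scale0r !addr0.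
  by rewrite -!addrA [a i + a j]addrC.
have cij : c i j = 1 by rewrite /c; lia.
have cji : c j i = - 1 by rewrite /c; lia.
have aij : a i *m a j *m a i = - a i by rewrite a_mul3 cij cji mul1r scaleN1r.
have aji : a j *m a i *m a j = - a j by rewrite a_mul3 cij cji mulr1 scaleN1r.
rewrite !(mulmxDl, mulmxDr, mul1mx, mulmx1) !a_sqr aij aji.
move: (a i *m a j) (a j *m a i) => ab ba.
by apply/matrixP => p q; rewrite !mxE; ring.
Qed.

Definition burau : braid n -> GLZ n := braid_lift burau_gen.

HB.instance Definition _ := isUMagmaMorphism.Build _ _ burau
  (braid_lift_umagma burau_relations).

Lemma burau_sigma i : val (burau (sigma i)) = burau_mx i.
Proof. by rewrite /burau (braid_lift_sigma burau_relations). Qed.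

Definition braid_congruence (m : nat) : set (braid n) :=
  [set b | eqmx_mod m (val (burau b)) 1%:M].

End Burau.

Arguments braid_congruence n m : clear implicits.

Section RhoBar.

Definition rhobar_mx (i : 'I_2) : 'M[int]_2 :=
  if i == 0 then mx2 1 1 0 1 else mx2 1 0 (- 1) 1.

Lemma rhobar_det (i : 'I_2) : \det (rhobar_mx i) == 1.
Proof.
rewrite (expand_det_row _ ord0) !big_ord_recl big_ord0 /cofactor !det_mx11.
by rewrite /rhobar_mx; case: ifP => _; rewrite !mxE.
Qed.

Definition rhobar_gen (i : 'I_3.-1) : SLZ 2 := mkSLZ (rhobar_det i).

Lemma rhobar_relations : @braid_relations 3 (SLZ 2) rhobar_gen.
Proof.
split=> i j ij; first by case: i j ij => [[|[|i]]] // ? [[|[|j]]].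
apply: val_inj => /=.
have -> : i = 0 by apply: val_inj; case: i j ij => [[|[|i]]] // ? [[|[|j]]].
have -> : j = 1 by apply: val_inj; case: i j ij => [[|[|i]]] // ? [[|[|j]]].
rewrite /rhobar_mx /=; apply/matrixP => p q.
rewrite !mxE !big_ord_recl !big_ord0 !mxE !big_ord_recl !big_ord0 !mxE /=.
by case: p q => [[|[|p]]] // ? [[|[|q]]].
Qed.

Definition rhobar : braid 3 -> SLZ 2 := @braid_lift 3 (SLZ 2) rhobar_gen.

HB.instance Definition _ := isUMagmaMorphism.Build _ _ rhobar
  (braid_lift_umagma rhobar_relations).

Lemma rhobar_sigma1 : val (rhobar sigma1) = mx2 1 1 0 1.
Proof. by rewrite /rhobar (braid_lift_sigma rhobar_relations). Qed.

Lemma rhobar_sigma2 : val (rhobar sigma2) = mx2 1 0 (- 1) 1.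
Proof. by rewrite /rhobar (braid_lift_sigma rhobar_relations). Qed.

End RhoBar.

(* Main.v *)
From HB Require Import structures.
Require Import Defs.
From mathcomp Require Import all_boot all_order all_algebra.
From mathcomp Require Import zify ring generic_quotient boolp classical_sets.

(* The kernel of rhobar is generated by (sigma1 sigma2)^6: modulo this element
   every 3-braid is a^k w t^d with a = sigma1 sigma2, t = sigma1 sigma2 sigma1
   and w a word in sigma2 and sigma1^-1, and such words have matrices whose
   diagonal entries are positive and whose other entries are nonpositive, so
   the product is trivial in SL_2(Z) only if it is empty. For n = 3, rho_3 is
   conjugate to rhobar (+) 1, and SL_2(Z)[m] is generated by SL_2(Z)[2m] and the
   conjugates of rhobar(sigma1)^m.

   For n = 4, put x = sigma1 sigma3^-1, y = sigma2 x sigma2^-1 and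
   c = y x^-1 y^-1 x. The subgroup <x, y> is normalised by B_3 and B_4 is their
   product. Conjugation by (sigma1 sigma2)^6 acts on <x, y> as conjugation by c,
   so modulo the candidate normal subgroup N the element c is central and every
   4-braid is x^i y^j c^k b with b in B_3. The orders of x, y and y x^-1 divide
   m modulo N, which kills c^k as soon as m divides 2k. Conversely, the last
   column of the Burau matrix shows that x^i y^j c^k b can only be trivial mod m
   if m divides i, j and 2k; then b lies in B_3[m]. *)

Set Implicit Arguments.
Unset Strict Implicit.
Unset Printing Implicit Defensive.

Import Order.TTheory GRing.Theory.

Local Open Scope classical_set_scope.
Local Open Scope quotient_scope.
Local Open Scope group_scope.

(** * Normal subgroups and quotients *)

Section NormalClosureTheory.
Variable G : groupType.

Lemma normal_closure_normal (S : set G) : normal_subgroup (normal_closure S).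
Proof.
split; first by move=> N [[]].
- move=> x y xS yS N NS; case: (NS) => -[_ NM _ _] _.
  by apply: NM; [exact: xS|exact: yS].
- by move=> x xS N NS; case: (NS) => -[_ _ NV _] _; apply: NV; exact: xS.
- by move=> x g xS N NS; case: (NS) => -[_ _ _ NJ] _; apply: NJ; exact: xS.
Qed.

Lemma sub_normal_closure (S : set G) : S `<=` normal_closure S.
Proof. by move=> x Sx N [_]; exact. Qed.

Lemma normal_closure_min (S N : set G) :
  normal_subgroup N -> S `<=` N -> normal_closure S `<=` N.
Proof. by move=> nN SN x; exact. Qed.

End NormalClosureTheory.

Section Quotient.
Variables (G : groupType) (N : set G).
Hypothesis nN : normal_subgroup N.

Definition quot_eqb : rel G := fun x y => `[< N (x / y) >].

Lemma quot_eqb_equiv : equiv_class_of quot_eqb.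
Proof.
case: nN => N1 NM NV NJ; split.
- by move=> x; apply/asboolP; rewrite mulgV.
- by move=> x y; apply/asboolP/asboolP => /NV; rewrite invgF.
- move=> y x z /asboolP xy /asboolP yz; apply/asboolP.
  by rewrite -(divgKA y); exact: NM.
Qed.

Canonical quot_equiv := EquivRelPack quot_eqb_equiv.
Definition quot_group := {eq_quot quot_equiv}.
HB.instance Definition _ := Choice.on quot_group.
HB.instance Definition _ := EqQuotient.on quot_group.

Definition quot_of (x : G) : quot_group := \pi x.

Lemma quot_ofP x y : quot_of x = quot_of y <-> N (x / y).
Proof. by split=> [/eqmodP/asboolP|Nxy] //; apply/eqmodP/asboolP. Qed.

Lemma repr_quot_of x : N (repr (quot_of x) / x).
Proof. by apply/quot_ofP; rewrite /quot_of reprK. Qed.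

Definition quot_mul (x y : quot_group) := quot_of (repr x * repr y).
Definition quot_inv (x : quot_group) := quot_of (repr x)^-1.

Lemma quot_mulE x y : quot_mul (quot_of x) (quot_of y) = quot_of (x * y).
Proof.
case: nN => N1 NM NV NJ; apply/quot_ofP.
set x' := repr _; set y' := repr _.
have -> : x' * y' / (x * y) = (y' / y) ^ x'^-1 * (x' / x).
  by rewrite conjgE invgK !invgM !mulgA !mulgVK.
by apply: NM; [apply: NJ|]; exact: repr_quot_of.
Qed.

Lemma quot_invE x : quot_inv (quot_of x) = quot_of x^-1.
Proof.
case: nN => N1 NM NV NJ; apply/quot_ofP; rewrite invgK.
have -> : (repr (quot_of x))^-1 * x = (repr (quot_of x) / x)^-1 ^ x.
  by rewrite conjgE invgF !mulgA mulVg mul1g.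
exact/NJ/NV/repr_quot_of.
Qed.

Lemma quot_group_ind (P : quot_group -> Prop) :
  (forall x, P (quot_of x)) -> forall u, P u.
Proof. by move=> Px u; rewrite -[u]reprK; exact: Px. Qed.

Lemma quot_mulA : associative quot_mul.
Proof.
elim/quot_group_ind=> x; elim/quot_group_ind=> y; elim/quot_group_ind=> z.
by rewrite !quot_mulE mulgA.
Qed.

Lemma quot_mul1 : left_id (quot_of 1) quot_mul.
Proof. by elim/quot_group_ind=> x; rewrite quot_mulE mul1g. Qed.

Lemma quot_mulr1 : right_id (quot_of 1) quot_mul.
Proof. by elim/quot_group_ind=> x; rewrite quot_mulE mulg1. Qed.

Lemma quot_mulVx : left_inverse (quot_of 1) quot_inv quot_mul.
Proof.
by elim/quot_group_ind=> x; rewrite quot_invE quot_mulE mulVg.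
Qed.

Lemma quot_mulxV : right_inverse (quot_of 1) quot_inv quot_mul.
Proof.
by elim/quot_group_ind=> x; rewrite quot_invE quot_mulE mulgV.
Qed.

HB.instance Definition _ := isGroup.Build quot_group
  quot_mulA quot_mul1 quot_mulr1 quot_mulVx quot_mulxV.

Lemma quot_of_morphism : monoid.monoid_morphism quot_of.
Proof. by split=> // x y; exact/esym/quot_mulE. Qed.

HB.instance Definition _ := isUMagmaMorphism.Build _ _ quot_of
  quot_of_morphism.

End Quotient.

(** Lets later arguments compute with equations in an abstract group in place of membership in
    [N]. *)
Lemma quotient_exists (G : groupType) (N : set G) : normal_subgroup N ->
  exists (H : groupType) (q : monoid.UMagmaMorphism.type G H),
    forall x y, q x = q y <-> N (x / y).
Proof.
by move=> nN; exists (quot_group nN), (@quot_of G N nN) => x y; exact: quot_ofP.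
Qed.

Lemma normal_subgroup_image (G H : groupType)
    (f : monoid.UMagmaMorphism.type G H) (N : set G) :
  (forall y, exists x, f x = y) ->
  normal_subgroup N -> normal_subgroup [set f x | x in N].
Proof.
move=> fsurj [N1 NM NV NJ]; split.
- by exists 1; rewrite ?gmulf1.
- move=> _ _ [x Nx <-] [y Ny <-].
  by exists (x * y); rewrite ?gmulfM //; exact: NM.
- by move=> _ [x Nx <-]; exists x^-1; rewrite ?gmulfV //; exact: NV.
- move=> _ g [x Nx <-]; have [h <-] := fsurj g.
  by exists (x ^ h); rewrite ?gmulfJ //; exact: NJ.
Qed.

Lemma normal_subgroup_preimage (G H : groupType)
    (f : monoid.UMagmaMorphism.type G H) (N : set H) :
  normal_subgroup N -> normal_subgroup (f @^-1` N).
Proof.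
move=> [N1 NM NV NJ]; split; rewrite /preimage /=.
- by rewrite gmulf1.
- by move=> x y; rewrite gmulfM; exact: NM.
- by move=> x; rewrite gmulfV; exact: NV.
- by move=> x g; rewrite gmulfJ; exact: NJ.
Qed.

Lemma braid_relV (G : groupType) (a b : G) :
  a * b * a = b * a * b -> a^-1 / b * a = b / a / b.
Proof.
move=> ab; apply: (mulIg b); apply: (mulIg a); rewrite !mulgVK.
by rewrite -!mulgA (mulgA a) ab -!mulgA !mulKg.
Qed.

(** * The fiber of B_4 over B_3 *)

Lemma expg_eq1_dvd (G : groupType) (a : G) m n :
  a ^+ m = 1 -> (m %| n)%N -> a ^+ n = 1.
Proof. by move=> am /dvdnP[k ->]; rewrite mulnC expgnA am expg1n. Qed.

(** Finite order turns inverses into positive powers, so the normal forms below need only natural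
    exponents. *)
Lemma expgV_order (G : groupType) (a : G) m :
  (0 < m)%N -> a ^+ m = 1 -> a^-1 = a ^+ m.-1.
Proof. by move=> m0 am; apply: mulg1_eq; rewrite -expgS prednK. Qed.

Lemma closed_expg_mul (G : groupType) (P : set G) u n g :
  (forall g, P g -> P (u * g)) -> P g -> P (u ^+ n * g).
Proof.
by move=> Pu Pg; elim: n => [|n IHn]; rewrite ?mul1g // expgS -mulgA; apply: Pu.
Qed.

(** Adjacent generators are conjugate, so a bound on the order of one passes to the next. *)
Lemma braid_rel_conj (G : groupType) (a b : G) :
  a * b * a = b * a * b -> a ^ (b * a) = b.
Proof.
by move=> ab; rewrite conjgE (mulgA a) ab mulKg.
Qed.

(** * Two elements with central commutator *)

Section Heisenberg.
Variables (G : groupType) (x y c : G).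
Hypotheses (cx : commute c x) (cy : commute c y) (xy : x * y = c * y * x).

Lemma heis_expg_mul n : x ^+ n * y = c ^+ n * y * x ^+ n.
Proof.
elim: n => [|n IHn]; first by rewrite !expg0 mul1g mulg1.
rewrite expgS -mulgA IHn 2!mulgA (commuteX n (commute_sym cx)) -(mulgA _ x).
by rewrite xy expgSr !mulgA.
Qed.

(** In [(y * x) ^+ n] there are ['C(n, 2)] pairs with an [x] before a [y]; exchanging each pair
    releases one central [c]. *)
Lemma heis_mulg_expg n : (y * x) ^+ n = c ^+ 'C(n, 2) * y ^+ n * x ^+ n.
Proof.
elim: n => [|n IHn]; first by rewrite !expg0 !mulg1.
rewrite expgSr IHn mulgA -(mulgA _ (x ^+ n)) heis_expg_mul.
rewrite binS bin1 expgnDr !expgSr !mulgA; congr (_ * _ * _ * _).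
by rewrite -!mulgA; congr (_ * _); apply/commuteX2/commute_sym.
Qed.

Variable m : nat.
Hypotheses (m0 : (0 < m)%N) (xm : x ^+ m = 1).

Lemma heis_c_expg : c ^+ m = 1.
Proof.
by apply: (mulIg y); have := heis_expg_mul m; rewrite xm mulg1 mul1g.
Qed.

(* For even [m], [(y * x) ^+ m = c ^+ 'C(m, 2) * y ^+ m * x ^+ m] forces
   [c ^+ (m * m.-1)./2 = 1], which is stronger than [c ^+ m = 1]. *)
Lemma heis_c_half k :
  y ^+ m = 1 -> (y * x) ^+ m = 1 -> (m %| k.*2)%N -> c ^+ k = 1.
Proof.
move=> ym yxm; have cm := heis_c_expg.
have: c ^+ 'C(m, 2) = 1 by have := heis_mulg_expg m; rewrite xm ym yxm !mulg1.
rewrite bin2; have [odd_m|even_m] := boolP (odd m) => cC m2k.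
  by apply: expg_eq1_dvd cm _; rewrite -(@Gauss_dvdr _ 2) ?mul2n ?coprimen2.
have /dvdnP[h mE] : (2 %| m)%N by rewrite dvdn2.
(* Since [m = 2h], the sum [h + m(m - 1)/2] equals [h m], a multiple of [m]. *)
have ch : c ^+ h = 1.
  have: c ^+ (h + (m * m.-1)./2) = 1.
    apply: expg_eq1_dvd cm _; apply/dvdnP; exists h.
    by case: (h) mE => [|h'] ->; lia.
  by rewrite expgnDr cC mulg1.
apply: expg_eq1_dvd ch _.
by move: m2k; rewrite mE -mul2n mulnC dvdn_pmul2l.
Qed.

End Heisenberg.

(** * Conjugation by three-strand braids on the fiber, and the resulting normal form *)

Section FourStrands.
Variables (G : groupType) (s1 s2 s3 : G).
Hypotheses (s13 : commute s1 s3) (s121 : s1 * s2 * s1 = s2 * s1 * s2)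
  (s232 : s2 * s3 * s2 = s3 * s2 * s3).

Variables x y c : G.
Hypotheses (xE : x = s1 / s3) (yE : y = s2 * x / s2) (cE : c = y / x / y * x).

Lemma conj_s1_x : x ^ s1^-1 = x.
Proof.
rewrite conjgE invgK mulgA; apply/(canLR (mulgK _)); rewrite xE.
exact/(commuteM (commute_refl _))/commuteV.
Qed.

Lemma conj_s2_x : x ^ s2^-1 = y.
Proof. by rewrite conjgE invgK mulgA yE. Qed.

(** As [x^-1 * s1 = s3], the claim amounts to [s1 * y = y * s3], which follows from the two braid
    relations, the second one with mixed signs. *)
Lemma conj_s1_y : y ^ s1^-1 = y / x.
Proof.
rewrite conjgE invgK mulgA; apply/(canLR (mulgK _)).
have -> : y / x * s1 = y * s3 by rewrite -mulgA xE invgF mulgVK.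
rewrite yE xE !mulgA s121 -!mulgA; congr (_ * (_ * _)).
by rewrite !mulgA (braid_relV (esym s232)).
Qed.

(** Write [y] as [(y / x) * x]. The factor [y / x] is [x] conjugated by [s2^-1 * s1^-1]; one more
    conjugation by [s2^-1] completes a braid relation, and since [s1] fixes [x] the result is
    [y / x] again. *)
Lemma conj_s2_y : y ^ s2^-1 = y / x * y.
Proof.
have s121V : s2^-1 / s1 / s2 = s1^-1 / s2 / s1.
  by rewrite -!invgM !mulgA s121.
rewrite -[y in LHS](mulgVK x) conjMg conj_s2_x -conj_s1_y -conj_s2_x.
by rewrite -!conjgM !mulgA s121V !conjgM conj_s1_x conj_s2_x conj_s1_y.
Qed.

Lemma conj_s1_c : c ^ s1^-1 = c.
Proof.
by rewrite cE !conjMg !conjVg conj_s1_x conj_s1_y invgF !gnorm.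
Qed.

Lemma conj_s2_c : c ^ s2^-1 = c.
Proof.
by rewrite cE !conjMg !conjVg conj_s2_x conj_s2_y !gnorm.
Qed.

(* Conjugation by the inverse of [(s1 * s2) ^+ 3] maps [x] to [c / x]
   and fixes [c]. *)
Lemma conj_full_twist_x : x ^ ((s1 * s2) ^+ 6)^-1 = c * x / c.
Proof.
set a := (s1 * s2)^-1.
have aE u : u ^ a = (u ^ s2^-1) ^ s1^-1 by rewrite -conjgM -invgM.
have ax : x ^ a = y / x by rewrite aE conj_s2_x conj_s1_y.
have ay : y ^ a = y / x / x * (y / x).
  by rewrite aE conj_s2_y !conjMg conjVg conj_s1_x conj_s1_y.
have ac : c ^ a = c by rewrite aE conj_s2_c conj_s1_c.
have a3 : x ^ (a * a * a) = c / x.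
  rewrite !conjgM ax conjMg conjVg ay ax mulgK.
  by rewrite !conjMg !conjVg ay ax cE !gnorm.
have ca3 : c ^ (a * a * a) = c by rewrite !conjgM !ac.
have -> : ((s1 * s2) ^+ 6)^-1 = a * a * a * (a * a * a).
  by rewrite /a -!invgM !expgS expg0 mulg1 !mulgA.
by rewrite conjgM a3 conjMg conjVg ca3 a3 invgF mulgA.
Qed.

Section FullTwistTrivial.
Hypothesis D1 : (s1 * s2) ^+ 6 = 1.

Lemma commute_fiber_cx : commute c x.
Proof.
by apply: (mulIg c^-1); rewrite mulgK -conj_full_twist_x D1 invg1 conjg1.
Qed.

Lemma commute_fiber_cy : commute c y.
Proof.
rewrite /commute -(conj_s2_x) -{1}conj_s2_c -conjMg commute_fiber_cx conjMg.
by rewrite conj_s2_c.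
Qed.

(** Since [c] commutes with [x], conjugating its definition by [x] rewrites it as [x * y / x / y],
    the shape required of a Heisenberg pair. *)
Lemma mul_fiber_xy : x * y = c * y * x.
Proof.
have -> : c = x * y / x / y.
  by rewrite -[LHS](mulgK x) commute_fiber_cx cE !gnorm.
by rewrite !gnorm.
Qed.

Variable m : nat.
Hypotheses (m0 : (0 < m)%N) (s1m : s1 ^+ m = 1).

Lemma braid_gen2_order : s2 ^+ m = 1.
Proof. by rewrite -(braid_rel_conj s121) -conjXg s1m conj1g. Qed.

Lemma braid_gen3_order : s3 ^+ m = 1.
Proof. by rewrite -(braid_rel_conj s232) -conjXg braid_gen2_order conj1g. Qed.

Lemma fiber_x_order : x ^+ m = 1.
Proof. by rewrite xE expgnFl // s1m braid_gen3_order divg1. Qed.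

Lemma fiber_y_order : y ^+ m = 1.
Proof. by rewrite -conj_s2_x -conjXg fiber_x_order conj1g. Qed.

Lemma fiber_yVx_order : (y / x) ^+ m = 1.
Proof. by rewrite -conj_s1_y -conjXg fiber_y_order conj1g. Qed.

Lemma fiber_c_order : c ^+ m = 1.
Proof. exact: (heis_c_expg commute_fiber_cx mul_fiber_xy fiber_x_order). Qed.

(** The Heisenberg pair used here is [x], [y / x]: its product [(y / x) * x] is [y], and all three
    elements are conjugate, so their orders divide [m]. *)
Lemma fiber_c_eq1 k : (m %| k.*2)%N -> c ^+ k = 1.
Proof.
have cw : commute c (y / x).
  exact/(commuteM commute_fiber_cy)/commuteV/commute_fiber_cx.
have xw : x * (y / x) = c * (y / x) * x.
  by rewrite -[RHS]mulgA mulgVK mulgA mul_fiber_xy mulgK.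
apply: (heis_c_half commute_fiber_cx cw xw m0 fiber_x_order fiber_yVx_order).
by rewrite mulgVK fiber_y_order.
Qed.

Variable K : set G.
Hypotheses (K1 : K 1) (Ks1 : forall h, K h -> K (s1 * h))
  (Ks2 : forall h, K h -> K (s2 * h)).

(** In the application [K] is the image of [B_3]. *)
Definition heis_form g :=
  exists i j k h, K h /\ g = x ^+ i * y ^+ j * c ^+ k * h.

Lemma heis_form_x g : heis_form g -> heis_form (x * g).
Proof.
move=> [i [j [k [h [Kh ->]]]]]; exists i.+1, j, k, h; split=> //.
by rewrite expgS !mulgA.
Qed.

Lemma heis_form_c g : heis_form g -> heis_form (c * g).
Proof.
move=> [i [j [k [h [Kh ->]]]]]; exists i, j, k.+1, h; split=> //.
rewrite !mulgA (commuteX i commute_fiber_cx).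
rewrite -(mulgA _ c) (commuteX j commute_fiber_cy).
by rewrite expgS !mulgA.
Qed.

Lemma heis_form_y g : heis_form g -> heis_form (y * g).
Proof.
move=> [i [j [k [h [Kh ->]]]]].
(* Moving [y] to the right past [x ^+ i] costs [c ^- i]; [c^-1] is written [c ^+ m.-1]. *)
have -> : y * (x ^+ i * y ^+ j * c ^+ k * h) =
    (c ^+ m.-1) ^+ i * (x ^+ i * y ^+ j.+1 * c ^+ k * h).
  rewrite !mulgA expgS !mulgA -(mulgA _ (x ^+ i)).
  rewrite (heis_expg_mul commute_fiber_cx mul_fiber_xy) !mulgA -expgnA -expgnDr.
  rewrite (_ : (m.-1 * i + i = m * i)%N); last by case: (m) m0 => // ?; lia.
  by rewrite expgnA fiber_c_order expg1n mul1g.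
apply: closed_expg_mul; last by exists i, j.+1, k, h.
by move=> {Kh}g; apply: closed_expg_mul => ?; exact: heis_form_c.
Qed.

Lemma heis_form_yVx g : heis_form g -> heis_form (y / x * g).
Proof.
move=> Hg; rewrite -mulgA (expgV_order m0 fiber_x_order).
by apply: heis_form_y; exact: (closed_expg_mul _ heis_form_x).
Qed.

(** Pushing [s1] to the right until it meets [K] replaces [x], [y], [c] by their conjugates, and
    left multiplication by each of these preserves the form. *)
Lemma heis_form_s1 g : heis_form g -> heis_form (s1 * g).
Proof.
move=> [i [j [k [h [Kh ->]]]]].
rewrite mulgA (conjgCV s1) !conjMg !conjXg.
rewrite conj_s1_x conj_s1_y conj_s1_c -!mulgA.
apply: (closed_expg_mul _ heis_form_x).
apply: (closed_expg_mul _ heis_form_yVx).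
by exists 0, 0, k, (s1 * h); rewrite !expg0 !mul1g; split=> //; exact: Ks1.
Qed.

Lemma heis_form_s2 g : heis_form g -> heis_form (s2 * g).
Proof.
move=> [i [j [k [h [Kh ->]]]]].
rewrite mulgA (conjgCV s2) !conjMg !conjXg.
rewrite conj_s2_x conj_s2_y conj_s2_c -!mulgA.
apply: (closed_expg_mul _ heis_form_y).
apply: closed_expg_mul.
  move=> u Hu; rewrite (mulgA y) -(mulgA (y / x)).
  exact/heis_form_yVx/heis_form_y.
by exists 0, 0, k, (s2 * h); rewrite !expg0 !mul1g; split=> //; exact: Ks2.
Qed.

Lemma heis_form_s3 g : heis_form g -> heis_form (s3 * g).
Proof.
move=> Hg; have -> : s3 = x ^+ m.-1 * s1.
  by rewrite -(expgV_order m0 fiber_x_order) xE invgF mulgVK.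
by rewrite -mulgA; exact/(closed_expg_mul _ heis_form_x)/heis_form_s1.
Qed.

Lemma heis_form1 : heis_form 1.
Proof. by exists 0, 0, 0, 1; rewrite !expg0 !mulg1. Qed.

End FullTwistTrivial.

End FourStrands.

(** * The kernel of rhobar *)

Lemma braid_ind n (P : braid n -> Prop) :
  P 1 -> (forall i g, P g -> P (sigma i * g)) ->
  (forall i g, P g -> P ((sigma i)^-1 * g)) -> forall g, P g.
Proof.
move=> P1 Ps PVs g; rewrite -[g]braid_of_word_repr.
elim: (repr g) => [|[i b] w IHw]; first exact: P1.
rewrite -cat1s braid_of_word_cat braid_of_word_letter.
by case: b; [exact: PVs|exact: Ps].
Qed.

Lemma sigma3E (i : 'I_3.-1) :
  sigma i = sigma1 :> braid 3 \/ sigma i = sigma2 :> braid 3.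
Proof.
by case: i => [[|[|//]] lti]; [left|right]; congr (sigma _); apply: val_inj.
Qed.

Lemma sigma12_adj n :
  sigma1 * sigma2 * sigma1 = sigma2 * sigma1 * sigma2 :> braid n.+3.
Proof. exact: sigma_adj. Qed.

(** * Normal form of 3-braids modulo [(sigma1 * sigma2) ^+ 6] *)

Section KernelForm.
Variables (G : groupType) (s1 s2 : G).
Hypotheses (s121 : s1 * s2 * s1 = s2 * s1 * s2) (D1 : (s1 * s2) ^+ 6 = 1).

Variables a t : G.
Hypotheses (aE : a = s1 * s2) (tE : t = s1 * s2 * s1).

Definition neg_word (w : seq bool) : G :=
  \prod_(b <- w) if b then s2 else s1^-1.

Definition kernel_form g := exists k w d, g = a ^+ k * neg_word w * t ^+ d.

(** The relation of the classical torus knot presentation of [B_3]; the common value is central. *)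
Lemma elliptic_rel : a ^+ 3 = t ^+ 2.
Proof. by rewrite aE tE expg2 !expgS expg0 mulg1 s121 -{1}s121 !mulgA. Qed.

Lemma elliptic6_order : a ^+ 6 = 1. Proof. by rewrite aE. Qed.

Lemma commute_elliptic p : commute t (a ^+ (3 * p)).
Proof.
by rewrite expgnA elliptic_rel; exact/commuteX/commuteX/commute_refl.
Qed.

Lemma kernel_form_a g : kernel_form g -> kernel_form (a * g).
Proof.
by move=> [k [w [d ->]]]; exists k.+1, w, d; rewrite expgS !mulgA.
Qed.

(** Write [k = 3p + r]; [t] commutes with [a ^+ (3 * p)]. If [r = 0], [t] merges with the first
    letter of the word into a power of [a], or joins the final power of [t] when the word is empty.
    If [r] is 1 or 2, [t * a ^+ r] is [a ^+ 3] times a new letter. *)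
Lemma kernel_form_t g : kernel_form g -> kernel_form (t * g).
Proof.
have ts1 : t / s1 = a ^+ 1 by rewrite expg1 tE aE mulgK.
have ts2 : t * s2 = a ^+ 2 by rewrite expg2 tE aE !mulgA.
have ta : t * a = a ^+ 3 / s1 by rewrite elliptic_rel expg2 -mulgA ts1 expg1.
have ta2 : t * a ^+ 2 = a ^+ 3 * s2 by rewrite elliptic_rel expg2 -mulgA ts2.
move=> [k [w [d ->]]]; rewrite (divn_eq k 3) mulnC.
set p := (k %/ 3)%N; have : (k %% 3 < 3)%N by rewrite ltn_mod.
have a_shift n h : a ^+ (3 * p) * (a ^+ n * h) = a ^+ (3 * p + n) * h.
  by rewrite mulgA -expgnDr.
rewrite expgnDr -!mulgA (mulgA t) commute_elliptic -mulgA.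
case: (k %% 3)%N => [|[|[|//]]] _.
- rewrite expg0 mul1g; case: w => [|[] w].
  + exists (3 * p)%N, [::], d.+1.
    by rewrite expgS /neg_word big_nil !mul1g mulg1.
  + exists (3 * p + 2)%N, w, d; rewrite /neg_word big_cons.
    by rewrite -(mulgA s2) (mulgA t) ts2 a_shift mulgA.
  + exists (3 * p + 1)%N, w, d; rewrite /neg_word big_cons.
    by rewrite -(mulgA s1^-1) (mulgA t) ts1 a_shift mulgA.
- exists (3 * p + 3)%N, (false :: w), d; rewrite /neg_word big_cons expg1.
  by rewrite (mulgA t) ta -a_shift !mulgA.
- exists (3 * p + 3)%N, (true :: w), d; rewrite /neg_word big_cons.
  by rewrite (mulgA t) ta2 -a_shift !mulgA.
Qed.

Lemma elliptic4_order : t ^+ 4 = 1.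
Proof.
by rewrite -[4]/(2 * 2)%N expgnA -elliptic_rel -expgnA elliptic6_order.
Qed.

(** The elements [a] and [t] satisfy [a ^+ 6 = t ^+ 4 = 1], so each generator and each inverse is a
    positive word in them. *)
Lemma kernel_form_s1 g : kernel_form g -> kernel_form (s1 * g).
Proof.
have -> : s1 = a ^+ 5 * t.
  by rewrite -(expgV_order (m := 6) isT elliptic6_order) tE aE mulKg.
by rewrite -mulgA => ?; exact/(closed_expg_mul _ kernel_form_a)/kernel_form_t.
Qed.

Lemma kernel_form_s1V g : kernel_form g -> kernel_form (s1^-1 * g).
Proof.
have -> : s1^-1 = t ^+ 3 * a.
  by rewrite -(expgV_order (m := 4) isT elliptic4_order) tE aE invgM mulgVK.
by rewrite -mulgA => ?; exact/(closed_expg_mul _ kernel_form_t)/kernel_form_a.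
Qed.

Lemma kernel_form_s2 g : kernel_form g -> kernel_form (s2 * g).
Proof.
have -> : s2 = s1^-1 * a by rewrite aE mulKg.
by rewrite -mulgA => ?; exact/kernel_form_s1V/kernel_form_a.
Qed.

Lemma kernel_form_s2V g : kernel_form g -> kernel_form (s2^-1 * g).
Proof.
have -> : s2^-1 = a ^+ 5 * s1.
  by rewrite -(expgV_order (m := 6) isT elliptic6_order) aE invgM mulgVK.
by rewrite -mulgA => ?; exact/(closed_expg_mul _ kernel_form_a)/kernel_form_s1.
Qed.

Lemma kernel_form1 : kernel_form 1.
Proof.
by exists 0, [::], 0; rewrite /neg_word big_nil !expg0 !mulg1.
Qed.

(** The even part of [t ^+ d] is a power of the central element [a ^+ 3]; it moves to the front,
    where exponents count modulo 6. *)
Lemma kernel_form_reduced g : kernel_form g ->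
  exists k w d, [/\ (k < 6)%N, (d < 2)%N & g = a ^+ k * neg_word w * t ^+ d].
Proof.
move=> [k [w [d ->]]]; pose p := (3 * (d %/ 2))%N.
have ap_a : commute (a ^+ p) a by exact/commute_sym/commuteX/commute_refl.
have ap_s1 : commute (a ^+ p) s1.
  have -> : s1 = a^-1 * t by rewrite tE -aE mulKg.
  by apply: commuteM; [exact: commuteV|exact/commute_sym/commute_elliptic].
have ap_w : commute (a ^+ p) (neg_word w).
  rewrite /neg_word; elim: w => [|b w IHw]; rewrite ?big_nil ?big_cons.
    exact: commute1.
  apply: commuteM IHw; case: b; last exact: commuteV.
  by rewrite -[s2](mulKg s1) -aE; apply: commuteM ap_a; exact: commuteV.
exists ((k + p) %% 6)%N, w, (d %% 2)%N; split; try exact: ltn_pmod.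
have -> : a ^+ ((k + p) %% 6) = a ^+ (k + p).
  by rewrite [in RHS](divn_eq (k + p) 6) expgnDr mulnC expgnA
    elliptic6_order expg1n mul1g.
have tp : t ^+ (2 * (d %/ 2)) = a ^+ p by rewrite expgnA -elliptic_rel -expgnA.
rewrite [in LHS](divn_eq d 2) mulnC expgnDr tp (expgnDr a k) -!mulgA.
by rewrite (mulgA (neg_word w)) -ap_w !mulgA.
Qed.
End KernelForm.

Local Open Scope ring_scope.

(** * Explicit two by two integer matrices and the sign argument *)

Lemma mx2_eta (A : 'M[int]_2) : A = mx2 (A 0 0) (A 0 1) (A 1 0) (A 1 1).
Proof.
apply/matrixP => i j; rewrite mxE.
by case: i j => [[|[|//]] ?] [[|[|//]] ?]; congr (A _ _); apply: val_inj.
Qed.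

Lemma mx2_entries a b c d : ((mx2 a b c d 0 0 = a) * (mx2 a b c d 0 1 = b) *
  (mx2 a b c d 1 0 = c) * (mx2 a b c d 1 1 = d))%type.
Proof. by rewrite !mxE. Qed.

Lemma mx2_inj a b c d a' b' c' d' : mx2 a b c d = mx2 a' b' c' d' ->
  [/\ a = a', b = b', c = c' & d = d'].
Proof.
move=> /matrixP e; have := (e 0 0, e 0 1, (e 1 0, e 1 1)).
by rewrite !mx2_entries => -[[-> ->] [-> ->]].
Qed.

Lemma mul_mx2 a b c d a' b' c' d' : mx2 a b c d *m mx2 a' b' c' d' =
  mx2 (a * a' + b * c') (a * b' + b * d') (c * a' + d * c') (c * b' + d * d').
Proof.
rewrite [LHS]mx2_eta !mxE !big_ord_recl !big_ord0 !mxE /=.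
by rewrite !addr0.
Qed.

Lemma mx2_1 : 1%:M = mx2 1 0 0 1.
Proof. by rewrite [LHS]mx2_eta !mxE. Qed.

Lemma det_mx2 a b c d : \det (mx2 a b c d) = a * d - b * c.
Proof.
rewrite (expand_det_row _ ord0) !big_ord_recl big_ord0 /cofactor !det_mx11.
by rewrite !mxE /=; ring.
Qed.

Lemma SLZ_mx2P (A : SLZ 2) : exists a b c d,
  val A = mx2 a b c d /\ a * d - b * c = 1.
Proof.
exists (val A 0 0), (val A 0 1), (val A 1 0), (val A 1 1).
by rewrite -det_mx2 -mx2_eta (eqP (valP A)).
Qed.

Lemma SLZ_mul_mx2 (A B : SLZ 2) a b c d a' b' c' d' :
  val A = mx2 a b c d -> val B = mx2 a' b' c' d' ->
  val (A * B)%g =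
  mx2 (a * a' + b * c') (a * b' + b * d') (c * a' + d * c') (c * b' + d * d').
Proof. by move=> /= -> ->; exact: mul_mx2. Qed.

Lemma SLZ_inv_mx2 (A : SLZ 2) a b c d :
  val A = mx2 a b c d -> val (A^-1)%g = mx2 d (- b) (- c) a.
Proof.
move=> Aval; have dA := eqP (valP A); rewrite Aval det_mx2 in dA.
have uA := SLZ_unitmx A.
apply: (can_inj (mulKmx uA)); rewrite mulmxV // Aval mul_mx2 mx2_1.
by congr mx2; lia.
Qed.

(** Left multiplication by a letter subtracts one row from the other. With these signs no diagonal
    entry decreases, no other entry increases, and one of the latter becomes strictly negative. *)
Lemma neg_word_mx2 (S1 S2 : SLZ 2) w :
  val S1 = mx2 1 1 0 1 -> val S2 = mx2 1 0 (- 1) 1 ->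
  exists p q r s, val (neg_word S1 S2 w) = mx2 p q r s /\
    [/\ 1 <= p, q <= 0, r <= 0, 1 <= s & w = [::] \/ q + r < 0].
Proof.
move=> S1E S2E; rewrite /neg_word; elim: w => [|b w].
  by exists 1, 0, 0, 1; rewrite big_nil /= mx2_1; split=> //; split=> //; left.
move=> [p [q [r [s [W [p1 q0 r0 s1 _]]]]]]; rewrite big_cons; case: b.
  exists p, q, (r - p), (s - q).
  by rewrite (SLZ_mul_mx2 S2E W); split; [congr mx2|split; try right]; lia.
exists (p - r), (q - s), r, s.
rewrite (SLZ_mul_mx2 (SLZ_inv_mx2 S1E) W).
by split; [congr mx2|split; try right]; lia.
Qed.

(** The word would equal one of twelve explicit matrices. Only the identity, at [k = d = 0], has
    positive diagonal and nonpositive other entries, and a nonempty word is not the identity. *)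
Lemma kernel_form_SLZ_eq1 (S1 S2 : SLZ 2) k w d :
  val S1 = mx2 1 1 0 1 -> val S2 = mx2 1 0 (- 1) 1 -> (k < 6)%N -> (d < 2)%N ->
  ((S1 * S2) ^+ k * neg_word S1 S2 w * (S1 * S2 * S1) ^+ d = 1)%g ->
  [/\ k = 0, w = [::] & d = 0]%N.
Proof.
move=> S1E S2E k6 d2 e1.
have [p [q [r [s [W [p1 q0 r0 s1 wE]]]]]] := neg_word_mx2 w S1E S2E.
have {e1}e1 : ((S1 * S2) ^+ k * neg_word S1 S2 w =
    ((S1 * S2 * S1) ^+ d)^-1)%g by apply/divg1_eq; rewrite invgK.
have a1 : val (S1 * S2)%g = mx2 0 1 (- 1) 1 by rewrite (SLZ_mul_mx2 S1E S2E).
have t1 : val (S1 * S2 * S1)%g = mx2 0 1 (- 1) 0.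
  by rewrite (SLZ_mul_mx2 a1 S1E).
have a0 : val ((S1 * S2) ^+ 0)%g = mx2 1 0 0 1 by rewrite /= mx2_1.
have a2 : val ((S1 * S2) ^+ 2)%g = mx2 (- 1) 1 (- 1) 0.
  by rewrite (SLZ_mul_mx2 a1 a1).
have a3 : val ((S1 * S2) ^+ 3)%g = mx2 (- 1) 0 0 (- 1).
  by rewrite (SLZ_mul_mx2 a1 a2).
have a4 : val ((S1 * S2) ^+ 4)%g = mx2 0 (- 1) 1 (- 1).
  by rewrite (SLZ_mul_mx2 a1 a3).
have a5 : val ((S1 * S2) ^+ 5)%g = mx2 1 (- 1) 1 0.
  by rewrite (SLZ_mul_mx2 a1 a4).
have t0 : val ((S1 * S2 * S1) ^+ 0)%g = mx2 1 0 0 1 by rewrite /= mx2_1.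
have contra k' d' a b c e f g h i : val ((S1 * S2) ^+ k')%g = mx2 a b c e ->
    val ((S1 * S2 * S1) ^+ d')%g = mx2 f g h i ->
    ((S1 * S2) ^+ k' * neg_word S1 S2 w = ((S1 * S2 * S1) ^+ d')^-1)%g ->
    [/\ a * p + b * r = i, a * q + b * s = - g,
        c * p + e * r = - h & c * q + e * s = f].
  move=> ak td /(congr1 val); rewrite (SLZ_mul_mx2 ak W) (SLZ_inv_mx2 td).
  exact: mx2_inj.
case: k k6 e1 => [|[|[|[|[|[|//]]]]]] _;
  case: d d2 => [|[|//]] _ /contra-/(_ _ _ _ _ _ _ _ _
    ltac:(eassumption) ltac:(eassumption)); case; try lia.
by move=> *; split=> //; case: wE => //; lia.
Qed.

Lemma rhobar_full_twist : rhobar ((sigma1 * sigma2) ^+ 6)%g = 1%g.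
Proof.
have a1 := SLZ_mul_mx2 rhobar_sigma1 rhobar_sigma2.
have a2 := SLZ_mul_mx2 a1 a1; have a3 := SLZ_mul_mx2 a1 a2.
by rewrite gmulfXn gmulfM (expgnA _ 3 2); apply: val_inj;
  rewrite (SLZ_mul_mx2 a3 a3) /= mx2_1.
Qed.

Lemma rhobar_sub_kernel b : rhobar b = 1%g ->
  normal_closure [set ((sigma1 : braid 3) * sigma2) ^+ 6]%g b.
Proof.
move=> b1; set N := normal_closure _.
have nN : normal_subgroup N by exact: normal_closure_normal.
have [Q [q qP]] := quotient_exists nN.
have qD : ((q sigma1 * q sigma2) ^+ 6 = 1)%g.
  rewrite -gmulfM -gmulfXn -(gmulf1 (s := q)); apply/qP.
  by rewrite divg1; exact: sub_normal_closure.
have q121 : (q sigma1 * q sigma2 * q sigma1 = q sigma2 * q sigma1 * q sigma2)%g.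
  by rewrite -!gmulfM sigma12_adj.
pose form := kernel_form (q sigma1) (q sigma2) (q sigma1 * q sigma2)%g
  (q sigma1 * q sigma2 * q sigma1)%g.
have qform : form (q b).
  elim/braid_ind: b {b1} => [|i g|i g]; rewrite ?gmulf1 ?gmulfM ?gmulfV.
  - exact: kernel_form1.
  - by case: (sigma3E i) => ->; [exact: kernel_form_s1|exact: kernel_form_s2].
  - by case: (sigma3E i) => ->; [exact: kernel_form_s1V|exact: kernel_form_s2V].
have [k [w [d [k6 d2]]]] := kernel_form_reduced q121 qD erefl erefl qform.
have -> : neg_word (q sigma1) (q sigma2) w = q (neg_word sigma1 sigma2 w).
  rewrite /neg_word gmulf_prod; apply: eq_bigr => -[] _ //.
  by rewrite gmulfV.
rewrite -!gmulfM -!gmulfXn -!gmulfM => qb.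
(* Hence equality modulo [N] can be read off in SL_2(Z). *)
have Nker : N `<=` [set g | rhobar g = 1%g].
  apply: normal_closure_min => [|_ ->].
    split=> [|x y /= x1 y1|x /= x1|x g /= x1].
    - exact: gmulf1.
    - by rewrite gmulfM /= x1 y1 mulg1.
    - by rewrite gmulfV /= x1 invg1.
    - by rewrite gmulfJ /= x1 conj1g.
  exact: rhobar_full_twist.
have : rhobar b = rhobar ((sigma1 * sigma2) ^+ k * neg_word sigma1 sigma2 w *
    (sigma1 * sigma2 * sigma1) ^+ d)%g.
  by apply/divg1_eq; rewrite -gmulfF; apply: Nker; apply/qP.
rewrite b1 !gmulfM !gmulfXn !gmulfM /=.
have -> : rhobar (neg_word sigma1 sigma2 w) =
    neg_word (rhobar sigma1) (rhobar sigma2) w.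
  rewrite /neg_word gmulf_prod; apply: eq_bigr => -[] _ //.
  by rewrite gmulfV.
move=> /esym.
move=> /(kernel_form_SLZ_eq1 rhobar_sigma1 rhobar_sigma2 k6 d2)[k0 w0 d0].
move: qb; rewrite k0 w0 d0 !expg0 /neg_word big_nil !mulg1 gmulf1.
by rewrite -(gmulf1 (s := q)) => /qP; rewrite divg1.
Qed.

(** * Generation of SL_2(Z) by two unipotent matrices *)

Section Generation.
Variables (S1 S2 : SLZ 2) (P : SLZ 2 -> Prop).
Hypotheses (S1E : val S1 = mx2 1 1 0 1) (S2E : val S2 = mx2 1 0 (- 1) 1).
Hypotheses (P1 : P 1%g)
  (PS1 : forall A, P A -> P (S1 * A)%g)
  (PS1V : forall A, P A -> P (S1^-1 * A)%g)
  (PS2 : forall A, P A -> P (S2 * A)%g)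
  (PS2V : forall A, P A -> P (S2^-1 * A)%g).

Let undo_S1 A : P (S1 * A)%g -> P A.
Proof. by move/PS1V; rewrite mulKg. Qed.
Let undo_S1V A : P (S1^-1 * A)%g -> P A.
Proof. by move/PS1; rewrite mulVKg. Qed.
Let undo_S2 A : P (S2 * A)%g -> P A.
Proof. by move/PS2V; rewrite mulKg. Qed.
Let undo_S2V A : P (S2^-1 * A)%g -> P A.
Proof. by move/PS2; rewrite mulVKg. Qed.

Lemma SLZ2_gen_unipotent A b : val A = mx2 1 b 0 1 -> P A.
Proof.
have [n] := ubnP `|b|%N; elim: n => // n IHn in A b * => bn AE.
have [b_lt|b_gt|b0] := ltgtP b 0; last first.
- suff -> : A = 1%g by [].
  by apply: val_inj; rewrite AE b0 /= mx2_1.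
- apply/undo_S1V/(IHn _ (b - 1)); first by lia.
  by rewrite (SLZ_mul_mx2 (SLZ_inv_mx2 S1E) AE); congr mx2; lia.
- apply/undo_S1/(IHn _ (b + 1)); first by lia.
  by rewrite (SLZ_mul_mx2 S1E AE); congr mx2; lia.
Qed.

Lemma SLZ2_gen_triangular A a b c d : val A = mx2 a b c d -> c = 0 -> P A.
Proof.
move=> AE c0; rewrite c0 in AE; have ad : a * d = 1.
  by have := eqP (valP A); rewrite AE det_mx2; lia.
have [[a1 d1]|[a1 d1]] : (a = 1 /\ d = 1) \/ (a = -1 /\ d = -1).
  have /eqP := congr1 absz ad; rewrite abszM muln_eq1 => /andP[/eqP a1 /eqP d1].
  have [aE|aE] : a = 1 \/ a = -1 by lia.
    by left; lia.
  by right; lia.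
  by apply: (@SLZ2_gen_unipotent A b); rewrite AE a1 d1.
(* The cube of [S1 * S2] is minus the identity, which reduces diagonal -1 to the unipotent case. *)
have S12E := SLZ_mul_mx2 S1E S2E.
have S12AE := SLZ_mul_mx2 S12E (SLZ_mul_mx2 S12E (SLZ_mul_mx2 S12E AE)).
suff : P (S1 * S2 * (S1 * S2 * (S1 * S2 * A)))%g.
  by rewrite -!mulgA => /undo_S1/undo_S2/undo_S1/undo_S2/undo_S1/undo_S2.
apply: (@SLZ2_gen_unipotent _ (- b)); rewrite S12AE a1 d1.
by congr mx2; lia.
Qed.

(** Euclid's algorithm on the first column [(a, c)]: [S1] and its inverse change [a] by [c], [S2]
    and its inverse change [c] by [a], and a suitable choice lowers the sum of absolute values. *)
Lemma SLZ2_gen A : P A.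
Proof.
have [a [b [c [d [AE dA]]]]] := SLZ_mx2P A.
have [n] := ubnP (`|a| + `|c|)%N.
elim: n => // n IHn in A a b c d AE dA * => acn.
have S1A := SLZ_mul_mx2 S1E AE.
have S2A := SLZ_mul_mx2 S2E AE.
have S1VA := SLZ_mul_mx2 (SLZ_inv_mx2 S1E) AE.
have S2VA := SLZ_mul_mx2 (SLZ_inv_mx2 S2E) AE.
have [c0|c0] := eqVneq c 0.
  exact: SLZ2_gen_triangular AE c0.
have [a0|a0] := eqVneq a 0.
  (* The first column goes from [(0, c)] to [(c, c)] and then to [(c, 0)]. *)
  have S2S1A := SLZ_mul_mx2 S2E S1A.
  apply/undo_S1/undo_S2.
  by apply: (SLZ2_gen_triangular S2S1A); rewrite a0; lia.
have [ac|ca] := leqP `|c|%N `|a|%N.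
  have [s|s] : (`|(a - c)%R| < `|a|)%N \/ (`|(a + c)%R| < `|a|)%N by lia.
    by apply/undo_S1V/(IHn _ _ _ _ _ S1VA); nia.
  by apply/undo_S1/(IHn _ _ _ _ _ S1A); nia.
have [s|s] : (`|(c - a)%R| < `|c|)%N \/ (`|(c + a)%R| < `|c|)%N by lia.
  by apply/undo_S2/(IHn _ _ _ _ _ S2A); nia.
by apply/undo_S2V/(IHn _ _ _ _ _ S2VA); nia.
Qed.

End Generation.

Lemma rhobar_surj A : exists b, rhobar b = A.
Proof.
pose P A := exists b, rhobar b = A.
apply: (SLZ2_gen (P := P) rhobar_sigma1 rhobar_sigma2).
- by exists 1%g; exact: gmulf1.
- by move=> _ [b <-]; exists (sigma1 * b)%g; exact: gmulfM.
- by move=> _ [b <-]; exists (sigma1^-1 * b)%g; rewrite gmulfM gmulfV.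
- by move=> _ [b <-]; exists (sigma2 * b)%g; exact: gmulfM.
- by move=> _ [b <-]; exists (sigma2^-1 * b)%g; rewrite gmulfM gmulfV.
Qed.

(** * Congruence subgroups *)

Lemma eqmx_modP n m (A B : 'M[int]_n) :
  eqmx_mod m A B <-> exists C, A = B + m%:Z *: C.
Proof.
split=> [AB | [C ->] i j]; last first.
  by rewrite !mxE addrC mulrC modzMDl.
exists (\matrix_(i, j) ((A i j - B i j) %/ m)%Z).
apply/matrixP => i j; rewrite !mxE mulrC divzK ?subrKC //.
by rewrite -eqz_mod_dvd; apply/eqP.
Qed.

Lemma SLZ2_congruenceP k (A : SLZ 2) : SLZ_congruence 2 k A <->
  exists a b c d,
    val A = mx2 (1 + k%:Z * a) (k%:Z * b) (k%:Z * c) (1 + k%:Z * d).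
Proof.
split=> [/eqmx_modP[C AC] | [a [b [c [d AE]]]]]; last first.
  apply/eqmx_modP; exists (mx2 a b c d); rewrite AE mx2_1.
  by rewrite [RHS]mx2_eta !mxE /= !add0r.
exists (C 0 0), (C 0 1), (C 1 0), (C 1 1).
by rewrite AC [LHS]mx2_eta !mxE /= !add0r.
Qed.

Lemma int_parity (x : int) : exists y, x = 2 * y \/ x = 2 * y + 1.
Proof. by exists (x %/ 2)%Z; lia. Qed.

Lemma SLZ_upper_expg (S : SLZ 2) b n :
  val S = mx2 1 b 0 1 -> val (S ^+ n)%g = mx2 1 (n%:Z * b) 0 1.
Proof.
move=> SE; elim: n => [|n IHn]; first by rewrite mul0r /= mx2_1.
by rewrite expgS (SLZ_mul_mx2 SE IHn); congr mx2; lia.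
Qed.

Lemma SLZ_lower_expg (S : SLZ 2) c n :
  val S = mx2 1 0 c 1 -> val (S ^+ n)%g = mx2 1 0 (n%:Z * c) 1.
Proof.
move=> SE; elim: n => [|n IHn]; first by rewrite mul0r /= mx2_1.
by rewrite expgS (SLZ_mul_mx2 SE IHn); congr mx2; lia.
Qed.

(* Each step fixes the parity of one entry of (A - 1) / m, in the order upper
   left, lower left, upper right; the determinant takes care of the last. *)
Lemma SLZ2_congruence_sub (M : set (SLZ 2)) m : (0 < m)%N ->
  normal_subgroup M -> M (rhobar sigma1 ^+ m)%g ->
  SLZ_congruence 2 (2 * m) `<=` M -> SLZ_congruence 2 m `<=` M.
Proof.
move=> m0 [M1 MM MV MJ] MT sub2m.
have undo h A : M h -> M (h * A)%g -> M A.
  by move=> /MV Mh /(MM _ _ Mh); rewrite mulKg.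
set S1 := rhobar sigma1 in MT *; set S2 := rhobar sigma2.
have S1E : val S1 = mx2 1 1 0 1 := rhobar_sigma1.
have S2E : val S2 = mx2 1 0 (- 1) 1 := rhobar_sigma2.
have S1m := SLZ_upper_expg m S1E; have S2m := SLZ_lower_expg m S2E.
have ML : M (S2 ^+ m)%g.
  rewrite -(@braid_rel_conj _ S1 S2) -?conjXg; first exact: MJ.
  by rewrite -!gmulfM sigma12_adj.
have MU : M ((S1 ^+ m) ^ S2)%g by exact: MJ.
have UE := SLZ_mul_mx2 (SLZ_inv_mx2 S2E) (SLZ_mul_mx2 S1m S2E).
(* The equation [det A = 1] with 1 subtracted and one factor [m] cancelled. *)
have det (A : SLZ 2) a b c d :
    val A = mx2 (1 + m%:Z * a) (m%:Z * b) (m%:Z * c) (1 + m%:Z * d) ->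
    a + d + m%:Z * (a * d - b * c) = 0.
  move=> AE; have := eqP (valP A); rewrite AE det_mx2 => dA.
  suff /eqP : m%:Z * (a + d + m%:Z * (a * d - b * c)) = 0.
    by rewrite mulf_eq0 => /orP[|/eqP //]; lia.
  by lia.
have step1 (A : SLZ 2) a b c d :
    val A = mx2 (1 + m%:Z * (2 * a)) (m%:Z * (2 * b))
                (m%:Z * (2 * c)) (1 + m%:Z * d) -> M A.
  move=> AE; have dA := det _ _ _ _ _ AE.
  apply: sub2m; apply/SLZ2_congruenceP.
  have [d' dE] : exists d', d = 2 * d'.
    by exists (2 * m%:Z * b * c - a - m%:Z * a * d); lia.
  by exists a, b, c, d'; rewrite AE dE; congr mx2; lia.
have step2 (A : SLZ 2) a b c d :
    val A = mx2 (1 + m%:Z * (2 * a)) (m%:Z * b)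
                (m%:Z * (2 * c)) (1 + m%:Z * d) -> M A.
  move=> AE; have dA := det _ _ _ _ _ AE.
  have [b' [bE|bE]] := int_parity b; first by apply: step1; rewrite AE bE.
  have [d' dE] : exists d', d = 2 * d'.
    by exists (m%:Z * b * c - a - m%:Z * a * d); lia.
  apply: (undo _ _ MT).
  apply: (step1 _ (a + m%:Z * c) (b' + 1 + m%:Z * d') c d).
  by rewrite (SLZ_mul_mx2 S1m AE) bE dE; congr mx2; lia.
have step3 (A : SLZ 2) a b c d :
    val A = mx2 (1 + m%:Z * (2 * a)) (m%:Z * b) (m%:Z * c) (1 + m%:Z * d) ->
    M A.
  move=> AE.
  have [c' [cE|cE]] := int_parity c; first by apply: step2; rewrite AE cE.
  apply: (undo _ _ ML).
  apply: (step2 _ a b (c' - m%:Z * a) (d - m%:Z * b)).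
  by rewrite (SLZ_mul_mx2 S2m AE) cE; congr mx2; lia.
move=> A /SLZ2_congruenceP[a [b [c [d AE]]]]; have dA := det _ _ _ _ _ AE.
have [a' [aE|aE]] := int_parity a; first by apply: step3; rewrite AE aE.
have [h [mE|mE]] := int_parity m.
  (* For even [m], multiplying by [S1 ^+ m] or [S2 ^+ m] keeps the parity of [a]. The conjugate
     [(S1 ^+ m) ^ S2] is [1 + m * mx2 (-1) 1 (-1) 1], whose odd upper left entry changes it. *)
  apply: (undo _ _ MU).
  have UAE := SLZ_mul_mx2 UE AE.
  apply: (step3 _ (a' - h * a + h * c) (b + d * m%:Z + 1 - m%:Z * b)
     (c + c * m%:Z - 1 - m%:Z * a) (d + 1 + m%:Z * d - m%:Z * b)).
  by rewrite UAE aE mE; congr mx2; lia.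
have [c' [cE|cE]] := int_parity c.
  (* With [a] and [m] odd and [c] even, the determinant relation reads [1 + d + d = 0] modulo 2. *)
  by move: dA; rewrite aE cE mE; lia.
apply: (undo _ _ MT).
apply: (step3 _ (a' + h * c + c' + 1) (b + 1 + m%:Z * d) c d).
by rewrite (SLZ_mul_mx2 S1m AE) aE mE cE; congr mx2; lia.
Qed.

Lemma braid_congruenceP n m (b : braid n) :
  braid_congruence n m b <-> exists C, val (burau b) = 1%:M + m%:Z *: C.
Proof. exact: eqmx_modP. Qed.

Lemma burau_mul n (x y : braid n) :
  val (burau (x * y)%g) = val (burau x) *m val (burau y).
Proof. by rewrite gmulfM. Qed.

Lemma burau_mulV n (x : braid n) : val (burau x^-1%g) *m val (burau x) = 1%:M.
Proof. by rewrite -burau_mul mulVg gmulf1. Qed.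

Lemma braid_congruence_normal n m : normal_subgroup (braid_congruence n m).
Proof.
split.
- by apply/braid_congruenceP; exists 0; rewrite gmulf1 scaler0 addr0.
- move=> x y /braid_congruenceP[C xC] /braid_congruenceP[D yD].
  apply/braid_congruenceP; exists (C + D + m%:Z *: (C *m D)).
  rewrite burau_mul xC yD.
  rewrite mulmxDl mul1mx mulmxDr mulmx1 -!scalemxAl -!scalemxAr.
  by rewrite !scalerDr -!addrA; congr (_ + _); rewrite addrCA.
- move=> x /braid_congruenceP[C xC]; apply/braid_congruenceP.
  exists (- (val (burau x^-1%g) *m C)).
  move: (burau_mulV x); rewrite xC mulmxDr mulmx1 -scalemxAr => <-.
  by rewrite scalerN addrK.
- move=> x g /braid_congruenceP[C xC]; apply/braid_congruenceP.
  exists (val (burau g^-1%g) *m (C *m val (burau g))).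
  rewrite !burau_mul xC mulmxDl mul1mx mulmxDr burau_mulV.
  by rewrite -scalemxAl -scalemxAr.
Qed.

Lemma burau_mx_rank1 n (i : 'I_n.-1) : burau_mx n i = 1%:M +
  \matrix_(j < n, k < n) (((j == i :> nat)%:R - (j == i.+1 :> nat)%:R) *
                          ((k == i :> nat)%:R + (k == i.+1 :> nat)%:R)).
Proof.
rewrite burau_mxE; congr (_ + _); apply/matrixP => j k.
rewrite !mxE big_ord_recl big_ord0 addr0 !mxE -!(inj_eq val_inj) /=.
by rewrite !andbT.
Qed.

(** The Burau matrix of a generator is a transvection [1 + u v] with [v u = 0], so its [m]-th power
    is [1 + m u v]. *)
Lemma sigma_expg_congruence n m (i : 'I_n.-1) :
  braid_congruence n m (sigma i ^+ m)%g.
Proof.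
have := burau_mxE i; set u := (X in X *m _); set v := (X in _ *m X) => iE.
have vu : v *m u = 0.
  rewrite /u /v mulmxDl !mulmxBr !mul_delta_mx_cond -!(inj_eq val_inj) /=.
  by rewrite !eqxx (gtn_eqF (ltnSn i)) (ltn_eqF (ltnSn i)) subr0 sub0r subrr.
apply/braid_congruenceP; exists (u *m v).
elim: m => [|m IHm]; first by rewrite gmulf1 scale0r addr0.
rewrite expgSr burau_mul IHm burau_sigma iE.
rewrite mulmxDr mulmx1 [X in _ + X = _]mulmxDl mul1mx -scalemxAl mulmxA.
rewrite -(mulmxA u) vu mulmx0 mul0mx scaler0 addr0 -addrA.
by rewrite -[m.+1]addn1 PoszD scalerDl scale1r.
Qed.

(** * The Burau representation on three strands compared with [rhobar] *)

Definition seqmx n (s : seq (seq int)) : 'M[int]_n :=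
  \matrix_(i, j) nth 0 (nth [::] s i) j.

(* The columns are e_1 - e_2, e_2 - e_3, on which rho_3 is rhobar, and the fixed
   vector (1, -1, 1). *)
Definition burau3_basis : 'M[int]_3 :=
  seqmx 3 [:: [:: 1; 0; 1]; [:: -1; 1; -1]; [:: 0; -1; 1]].
Definition burau3_cobasis : 'M[int]_3 :=
  seqmx 3 [:: [:: 0; -1; -1]; [:: 1; 1; 0]; [:: 1; 1; 1]].

Lemma burau3_basisK : burau3_cobasis *m burau3_basis = 1%:M.
Proof.
apply/matrixP => i j; rewrite !mxE !big_ord_recl big_ord0 !mxE.
by case: i j => [[|[|[|//]]] ?] [[|[|[|//]]] ?].
Qed.

Lemma burau3_cobasisK : burau3_basis *m burau3_cobasis = 1%:M.
Proof. exact/mulmx1C/burau3_basisK. Qed.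

Definition rhobar_block (b : braid 3) : 'M[int]_(2 + 1) :=
  block_mx (val (rhobar b)) 0 0 1%:M.

Lemma rhobar_block_mul x y :
  rhobar_block (x * y)%g = rhobar_block x *m rhobar_block y.
Proof.
rewrite /rhobar_block gmulfM mulmx_block.
by rewrite !mul0mx !mulmx0 mulmx1 !addr0 !add0r.
Qed.

Lemma block_mx2 a b c d : block_mx (mx2 a b c d) 0 0 1%:M =
  seqmx 3 [:: [:: a; b; 0]; [:: c; d; 0]; [:: 0; 0; 1]].
Proof.
apply/matrixP => i j.
case: (@split_ordP 2 1 i) => i' ->; case: (@split_ordP 2 1 j) => j' ->.
- by rewrite block_mxEul !mxE; case: i' j' => [[|[|//]] ?] [[|[|//]] ?].
- by rewrite block_mxEur !mxE !ord1; case: i' => [[|[|//]] ?].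
- by rewrite block_mxEdl !mxE !ord1; case: j' => [[|[|//]] ?].
- by rewrite block_mxEdr !mxE !ord1.
Qed.

Lemma burau3_sigma i : val (burau (sigma i)) *m burau3_basis =
  burau3_basis *m rhobar_block (sigma i).
Proof.
rewrite burau_sigma burau_mx_rank1 /rhobar_block /rhobar.
rewrite (braid_lift_sigma rhobar_relations) /= /rhobar_mx.
by case: i => [[|[|//]] ?]; rewrite /= block_mx2; apply/matrixP => j k;
  rewrite !mxE !big_ord_recl !big_ord0 !mxE;
  case: j k => [[|[|[|//]]] ?] [[|[|[|//]]] ?].
Qed.

Lemma burau3_rhobar b :
  val (burau b) *m burau3_basis = burau3_basis *m rhobar_block b.
Proof.
elim/braid_ind: b => [|i g IHg|i g IHg].
- rewrite /rhobar_block !gmulf1 /= -scalar_mx_block mul1mx.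
  exact/esym/mulmx1.
- by rewrite burau_mul rhobar_block_mul -mulmxA IHg !mulmxA burau3_sigma.
- rewrite burau_mul -mulmxA.
  have : val (burau (sigma i)) *m
      (burau3_basis *m rhobar_block ((sigma i)^-1 * g)%g) =
      burau3_basis *m rhobar_block g.
    by rewrite mulmxA burau3_sigma -mulmxA -rhobar_block_mul mulVKg.
  rewrite IHg => <-; rewrite (mulmxA (val (burau (sigma i)^-1%g))).
  by rewrite burau_mulV mul1mx.
Qed.

Lemma braid_congruence3_rhobar m b :
  braid_congruence 3 m b -> SLZ_congruence 2 m (rhobar b).
Proof.
move=> /braid_congruenceP[C bC]; apply/eqmx_modP.
have : rhobar_block b = 1%:M + m%:Z *: (burau3_cobasis *m (C *m burau3_basis)).
  rewrite -[LHS]mul1mx -burau3_basisK -mulmxA -burau3_rhobar bC.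
  by rewrite mulmxDl mul1mx mulmxDr -scalemxAl -scalemxAr.
rewrite /rhobar_block => /(congr1 ulsubmx); rewrite block_mxKul => ->.
exists (@ulsubmx _ 2 1 2 1 (burau3_cobasis *m (C *m burau3_basis))).
by apply/matrixP => i j; rewrite !mxE.
Qed.

Lemma rhobar1_congruence3 m b : rhobar b = 1%g -> braid_congruence 3 m b.
Proof.
move=> b1; apply/braid_congruenceP; exists 0; rewrite scaler0 addr0.
rewrite -[LHS]mulmx1 -burau3_cobasisK mulmxA burau3_rhobar /rhobar_block b1.
by rewrite /= -scalar_mx_block mulmx1.
Qed.

(** * Burau matrices on four strands and the last basis vector *)

Lemma burau4_incl b :
  val (burau (braid_incl b)) = block_mx (val (burau b)) 0 0 1%:M :> 'M_(3 + 1).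
Proof.
have sE (i : 'I_3.-1) : val (burau (@sigma 4 (widen_ord (leq_pred 3) i))) =
    block_mx (val (burau (sigma i))) 0 0 1%:M :> 'M_(3 + 1).
  rewrite !burau_sigma !burau_mx_rank1; apply/matrixP => j k.
  case: (@split_ordP 3 1 j) => j' ->; case: (@split_ordP 3 1 k) => k' ->.
  - by rewrite block_mxEul !mxE.
  - rewrite block_mxEur !mxE !ord1.
    by case: i j' => [[|[|//]] ?] [[|[|[|//]]] ?].
  - rewrite block_mxEdl !mxE !ord1.
    by case: i k' => [[|[|//]] ?] [[|[|[|//]]] ?].
  - by rewrite block_mxEdr !mxE !ord1; case: i => [[|[|//]] ?].
have blkM (A B : 'M[int]_3) : block_mx A 0 0 1%:M *m block_mx B 0 0 1%:M =
    block_mx (A *m B) 0 0 1%:M :> 'M_(3 + 1).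
  by rewrite mulmx_block !mul0mx !mulmx0 mulmx1 !addr0 !add0r.
have inclM (x y : braid 3) :
    braid_incl (x * y)%g = (braid_incl x * braid_incl y)%g by exact: gmulfM.
have inclV (x : braid 3) : braid_incl x^-1%g = (braid_incl x)^-1%g.
  exact: gmulfV.
elim/braid_ind: b => [|i g IHg|i g IHg].
- by rewrite !gmulf1 /= -scalar_mx_block.
- rewrite inclM !burau_mul IHg braid_incl_sigma sE.
  exact: blkM.
- rewrite inclM inclV !burau_mul braid_incl_sigma IHg.
  have <- : block_mx (val (burau (sigma i))) 0 0 1%:M *m
     block_mx (val (burau (sigma i)^-1%g) *m val (burau g)) 0 0 1%:M =
     block_mx (val (burau g)) 0 0 1%:M :> 'M_(3 + 1).
    by rewrite blkM mulmxA -burau_mul mulgV gmulf1 mul1mx.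
  by rewrite -sE (mulmxA (val (burau _^-1%g))) burau_mulV mul1mx.
Qed.

Definition cv4 (p q r s : int) : 'cV[int]_4 := \col_i nth 0 [:: p; q; r; s] i.

Definition act (b : braid 4) (v : 'cV[int]_4) := val (burau b) *m v.

Lemma actM x y v : act (x * y)%g v = act x (act y v).
Proof. by rewrite /act burau_mul mulmxA. Qed.

Lemma actK x v w : act x v = w -> act x^-1%g w = v.
Proof. by move=> <-; rewrite -actM mulVg /act gmulf1 mul1mx. Qed.

Lemma act1 v : act 1%g v = v.
Proof. by rewrite /act gmulf1 mul1mx. Qed.

Definition sigma3 : braid 4 := @sigma 4 (@Ordinal 3 2 isT).

Lemma act_sigma1 p q r s : act sigma1 (cv4 p q r s) = cv4 (2 * p + q) (- p) r s.
Proof.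
rewrite /act burau_sigma burau_mx_rank1; apply/matrixP => i j.
rewrite !mxE !big_ord_recl !big_ord0 !mxE.
by case: i => [[|[|[|[|//]]]] ?] /=; lia.
Qed.
Lemma act_sigma2 p q r s : act sigma2 (cv4 p q r s) = cv4 p (2 * q + r) (- q) s.
Proof.
rewrite /act burau_sigma burau_mx_rank1; apply/matrixP => i j.
rewrite !mxE !big_ord_recl !big_ord0 !mxE.
by case: i => [[|[|[|[|//]]]] ?] /=; lia.
Qed.
Lemma act_sigma3 p q r s : act sigma3 (cv4 p q r s) = cv4 p q (2 * r + s) (- r).
Proof.
rewrite /act burau_sigma burau_mx_rank1; apply/matrixP => i j.
rewrite !mxE !big_ord_recl !big_ord0 !mxE.
by case: i => [[|[|[|[|//]]]] ?] /=; lia.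
Qed.

Lemma act_sigma1V p q r s :
  act sigma1^-1%g (cv4 p q r s) = cv4 (- q) (p + 2 * q) r s.
Proof. by apply: actK; rewrite act_sigma1; congr cv4; lia. Qed.
Lemma act_sigma2V p q r s :
  act sigma2^-1%g (cv4 p q r s) = cv4 p (- r) (q + 2 * r) s.
Proof. by apply: actK; rewrite act_sigma2; congr cv4; lia. Qed.
Lemma act_sigma3V p q r s :
  act sigma3^-1%g (cv4 p q r s) = cv4 p q (- s) (r + 2 * s).
Proof. by apply: actK; rewrite act_sigma3; congr cv4; lia. Qed.

Definition act_sigma := (act_sigma1, act_sigma2, act_sigma3,
  act_sigma1V, act_sigma2V, act_sigma3V).

(** [fiber_x] and [fiber_y] are the classical free generators of the kernel of the map from [B_4] to
    [B_3] that sends the third generator to the first; [fiber_c] is the commutator of [fiber_y] and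
    [fiber_x^-1]. *)
Definition fiber_x : braid 4 := (sigma1 / sigma3)%g.
Definition fiber_y : braid 4 := (sigma2 * fiber_x / sigma2)%g.
Definition fiber_c : braid 4 := (fiber_y / fiber_x / fiber_y * fiber_x)%g.

Lemma act_fiber_x p q r s :
  act fiber_x (cv4 p q r s) = cv4 (2 * p + q) (- p) (- s) (r + 2 * s).
Proof. by rewrite !(actM, act_sigma). Qed.

Lemma act_fiber_y p q r s :
  act fiber_y (cv4 p q r s) =
  cv4 (2 * p - r) (- 2 * p - s) p (q + 2 * r + 2 * s).
Proof. by rewrite !(actM, act_sigma); congr cv4; lia. Qed.

(** A transvection along [(-1, 1, -1, 1)], preserving the coordinate sum [u]. Its factor 2 is why
    only [2k], not [k], is controlled modulo [m]. *)
Lemma act_fiber_c p q r s (u := p + q + r + s) : act fiber_c (cv4 p q r s) =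
  cv4 (p - 2 * u) (q + 2 * u) (r - 2 * u) (s + 2 * u).
Proof.
rewrite /fiber_c /fiber_y /fiber_x !(invgM, invgK, actM, act_sigma).
by congr cv4; lia.
Qed.

Lemma act_fiber i j k :
  act (fiber_x ^+ i * fiber_y ^+ j * fiber_c ^+ k)%g (cv4 0 0 0 1) =
  cv4 (- (2 * k%:Z + i%:Z * j%:Z)) (2 * k%:Z + i%:Z * j%:Z - j%:Z)
        (- (2 * k%:Z + i%:Z * j%:Z) - i%:Z)
        (1 + 2 * k%:Z + i%:Z * j%:Z + i%:Z + j%:Z).
Proof.
elim: i => [|i IHi]; last first.
  by rewrite expgS -2!mulgA actM mulgA IHi act_fiber_x; congr cv4; lia.
rewrite expg0 mul1g; elim: j => [|j IHj]; last first.
  by rewrite expgS -mulgA actM IHj act_fiber_y; congr cv4; lia.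
rewrite expg0 mul1g; elim: k => [|k IHk]; last first.
  by rewrite expgS actM IHk act_fiber_c; congr cv4; lia.
by rewrite expg0 act1; congr cv4; lia.
Qed.

Lemma braid_inclM (x y : braid 3) :
  braid_incl (x * y)%g = (braid_incl x * braid_incl y)%g.
Proof. exact: gmulfM. Qed.

Lemma braid_incl_sigma1 : braid_incl (sigma1 : braid 3) = sigma1.
Proof. by rewrite braid_incl_sigma; congr sigma; apply: val_inj. Qed.

Lemma braid_incl_sigma2 : braid_incl (sigma2 : braid 3) = sigma2.
Proof. by rewrite braid_incl_sigma; congr sigma; apply: val_inj. Qed.

Lemma act_incl b : act (braid_incl b) (cv4 0 0 0 1) = cv4 0 0 0 1.
Proof.
elim/braid_ind: b => [|i g IHg|i g IHg]; first by rewrite gmulf1 act1.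
  rewrite braid_inclM actM IHg.
  by case: (sigma3E i) => ->;
    rewrite ?braid_incl_sigma1 ?braid_incl_sigma2 !act_sigma.
rewrite braid_inclM actM IHg gmulfV /=.
by case: (sigma3E i) => ->;
  rewrite ?braid_incl_sigma1 ?braid_incl_sigma2 !act_sigma.
Qed.

(** Braids from [B_3] fix the last basis vector, so its image depends on the fiber part alone. *)
Lemma fiber_congruence m i j k b :
  braid_congruence 4 m
    (fiber_x ^+ i * fiber_y ^+ j * fiber_c ^+ k * braid_incl b)%g ->
  [/\ (m %| i)%N, (m %| j)%N & (m %| k.*2)%N].
Proof.
move=> /braid_congruenceP[C gC].
have : act (fiber_x ^+ i * fiber_y ^+ j * fiber_c ^+ k * braid_incl b)%g
    (cv4 0 0 0 1) = cv4 0 0 0 1 + m%:Z *: (C *m cv4 0 0 0 1).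
  by rewrite /act gC mulmxDl mul1mx -scalemxAl.
rewrite actM act_incl act_fiber; move: (C *m _) => v e.
have [w0 e0] : exists w, - (2 * k%:Z + i%:Z * j%:Z) = m%:Z * w.
  by have /matrixP/(_ (@Ordinal 4 0 isT) 0) := e; rewrite !mxE /= add0r;
    exists (v (@Ordinal 4 0 isT) 0).
have [w1 e1] : exists w, 2 * k%:Z + i%:Z * j%:Z - j%:Z = m%:Z * w.
  by have /matrixP/(_ (@Ordinal 4 1 isT) 0) := e; rewrite !mxE /= add0r;
    exists (v (@Ordinal 4 1 isT) 0).
have [w2 e2] : exists w, - (2 * k%:Z + i%:Z * j%:Z) - i%:Z = m%:Z * w.
  by have /matrixP/(_ (@Ordinal 4 2 isT) 0) := e; rewrite !mxE /= add0r;
    exists (v (@Ordinal 4 2 isT) 0).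
(* Coordinates 0 and 2 differ by [i], coordinates 0 and 1 add up to [-j]; once [m] divides [i],
   coordinate 0 leaves [2k]. *)
have iE : i%:Z = (w0 - w2) * m%:Z by lia.
split; apply/(@dvdzP m%:Z (Posz _)).
- by exists (w0 - w2).
- by exists (- w0 - w1); lia.
- by exists (- w0 - (w0 - w2) * j%:Z); move: e0; rewrite iE; lia.
Qed.

Local Close Scope ring_scope.

(** * Normal generation on three and on four strands *)

Lemma braid_congruence_incl m b :
  braid_congruence 4 m (braid_incl b) <-> braid_congruence 3 m b.
Proof.
have bE := burau4_incl b; split=> [b4 i j | /eqmx_modP[C bC]].
  have ij : val (burau (braid_incl b)) (@lshift 3 1 i) (@lshift 3 1 j) =
      val (burau b) i j by rewrite bE; exact: block_mxEul.
  by have := b4 (@lshift 3 1 i) (@lshift 3 1 j); rewrite ij !mxE.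
apply/braid_congruenceP; exists (block_mx C 0 0 0 : 'M_(3 + 1)).
rewrite bE bC (_ : block_mx _ _ _ _ = 1%:M + m%:Z *: block_mx C 0 0 0)%R //.
by rewrite (@scalar_mx_block _ 3 1) scale_block_mx add_block_mx !scaler0 !addr0.
Qed.

(** The image of the normal closure under [rhobar] contains SL_2(Z)[m], so [b] has the same image as
    some [n] in the closure; then [b / n] lies in the kernel, which [(sigma1 * sigma2) ^+ 6]
    normally generates. *)
Lemma braid3_congruence_generation m (R : set (braid 3)) : (0 < m)%N ->
  R `<=` braid_congruence 3 m ->
  SLZ_congruence 2 (2 * m)%N `<=` normal_closure [set rhobar r | r in R] ->
  braid_congruence 3 m =
    normal_closure
      (R `|` [set (sigma1 : braid 3) ^+ m; ((sigma1 : braid 3) * sigma2) ^+ 6]).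
Proof.
move=> m0 Rm R2m; set S := R `|` _; apply/seteqP; split; last first.
  apply: normal_closure_min; first exact: braid_congruence_normal.
  move=> b [/Rm //|[->|->]]; first exact: sigma_expg_congruence.
  exact/rhobar1_congruence3/rhobar_full_twist.
have nN := normal_closure_normal S; have SN := @sub_normal_closure _ S.
have [N1 NM NV NJ] := nN.
move=> b /braid_congruence3_rhobar.
have nM : normal_subgroup [set rhobar x | x in normal_closure S].
  exact: (normal_subgroup_image rhobar_surj nN).
case/(SLZ2_congruence_sub m0 nM).
- by exists (sigma1 ^+ m); [apply: SN; right; left|exact: gmulfXn].
- apply: (subset_trans R2m); apply: normal_closure_min nM _.
  by move=> _ [r Rr <-]; exists r => //; apply: SN; left.
move=> n Nn nb; rewrite -(mulgVK n b); apply: NM Nn.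
have : normal_closure [set (sigma1 * sigma2 : braid 3) ^+ 6] (b / n).
  by apply: rhobar_sub_kernel; rewrite gmulfF /= nb mulgV.
apply: normal_closure_min nN _ _ => _ ->.
by apply: SN; right; right.
Qed.

Lemma sigma4E (i : 'I_4.-1) :
  [\/ sigma i = sigma1 :> braid 4, sigma i = sigma2 :> braid 4
    | sigma i = sigma3 :> braid 4].
Proof.
by case: i => [[|[|[|//]]] lti]; [constructor 1|constructor 2|constructor 3];
  congr (sigma _); apply: val_inj.
Qed.

Section FiberQuotient.
Variables (G : groupType) (q : monoid.UMagmaMorphism.type (braid 4) G).
Variable m : nat.
Hypotheses (m0 : (0 < m)%N) (s1m : q sigma1 ^+ m = 1)
  (D1 : (q sigma1 * q sigma2) ^+ 6 = 1).

Let s13 : commute (q sigma1) (q sigma3).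
Proof. by rewrite /commute -!gmulfM; congr (q _); exact: sigma_far. Qed.

Let s121 : q sigma1 * q sigma2 * q sigma1 = q sigma2 * q sigma1 * q sigma2.
Proof. by rewrite -!gmulfM sigma12_adj. Qed.

Let s232 : q sigma2 * q sigma3 * q sigma2 = q sigma3 * q sigma2 * q sigma3.
Proof. by rewrite -!gmulfM; congr (q _); exact: sigma_adj. Qed.

Let xE : q fiber_x = q sigma1 / q sigma3.
Proof. exact: gmulfF. Qed.

Let yE : q fiber_y = q sigma2 * q fiber_x / q sigma2.
Proof. by rewrite gmulfF gmulfM. Qed.

Let cE : q fiber_c = q fiber_y / q fiber_x / q fiber_y * q fiber_x.
Proof. by rewrite gmulfM !gmulfF. Qed.

Lemma fiber_eq1 i j k : (m %| i)%N -> (m %| j)%N -> (m %| k.*2)%N ->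
  q (fiber_x ^+ i * fiber_y ^+ j * fiber_c ^+ k) = 1.
Proof.
move=> mi mj mk; rewrite !gmulfM !gmulfXn.
rewrite (expg_eq1_dvd (fiber_x_order s13 s121 s232 xE s1m) mi).
rewrite (expg_eq1_dvd (fiber_y_order s13 s121 s232 xE yE s1m) mj).
by rewrite (fiber_c_eq1 s13 s121 s232 xE yE cE D1 m0 s1m mk) !mulg1.
Qed.

Lemma braid4_fiber_form g : exists i j k b,
  q g = q (fiber_x ^+ i * fiber_y ^+ j * fiber_c ^+ k * braid_incl b).
Proof.
pose K : set G := [set q (braid_incl b) | b in setT].
have K1 : K 1 by exists 1; rewrite ?gmulf1.
have Ks1 h : K h -> K (q sigma1 * h).
  move=> [b _ <-]; exists (sigma1 * b) => //.
  by rewrite braid_inclM braid_incl_sigma1 gmulfM.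
have Ks2 h : K h -> K (q sigma2 * h).
  move=> [b _ <-]; exists (sigma2 * b) => //.
  by rewrite braid_inclM braid_incl_sigma2 gmulfM.
have Hs1 := heis_form_s1 s13 s121 s232 xE yE cE D1 m0 s1m Ks1.
have Hs2 := heis_form_s2 s13 s121 s232 xE yE cE D1 m0 s1m Ks2.
have Hs3 := heis_form_s3 s13 s121 s232 xE yE cE D1 m0 s1m Ks1.
(* All generators have order dividing [m] in the quotient, so stability of the form under the
   generators covers their inverses. *)
have s1V := expgV_order m0 s1m.
have s2V := expgV_order m0 (braid_gen2_order s121 s1m).
have s3V := expgV_order m0 (braid_gen3_order s121 s232 s1m).
suff [i [j [k [_ [[b _ <-] ->]]]]] :
    heis_form (q fiber_x) (q fiber_y) (q fiber_c) K (q g).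
  by exists i, j, k, b; rewrite -!gmulfXn -!gmulfM.
elim/braid_ind: g => [|i g IHg|i g IHg].
- by rewrite gmulf1; exact: heis_form1.
- rewrite [X in heis_form _ _ _ _ X]gmulfM.
  by case: (sigma4E i) => ->; [exact: Hs1|exact: Hs2|exact: Hs3].
- rewrite [X in heis_form _ _ _ _ X]gmulfM gmulfV; case: (sigma4E i) => ->.
  + by rewrite s1V; exact: (closed_expg_mul _ Hs1).
  + by rewrite s2V; exact: (closed_expg_mul _ Hs2).
  + by rewrite s3V; exact: (closed_expg_mul _ Hs3).
Qed.

End FiberQuotient.

Theorem theorem3 (m : nat) (R : set (braid 3)) :
  (1 <= m)%N ->
  R `<=` braid_congruence 3 m ->
  SLZ_congruence 2 (2 * m)%N `<=` normal_closure [set rhobar r | r in R] ->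
  braid_congruence 3 m =
    normal_closure
      (R `|` [set (sigma1 : braid 3) ^+ m; ((sigma1 : braid 3) * sigma2) ^+ 6])
  /\
  braid_congruence 4 m =
    normal_closure
      ([set braid_incl r | r in R] `|`
       [set (sigma1 : braid 4) ^+ m; ((sigma1 : braid 4) * sigma2) ^+ 6]).
Proof.
move=> m0 Rm R2m; have B3 := braid3_congruence_generation m0 Rm R2m.
split=> //; set S := _ `|` _.
have inclX (b : braid 3) n : braid_incl (b ^+ n) = braid_incl b ^+ n.
  exact: gmulfXn.
have DE : braid_incl (((sigma1 : braid 3) * sigma2) ^+ 6) =
    (sigma1 * sigma2) ^+ 6.
  by rewrite inclX braid_inclM braid_incl_sigma1 braid_incl_sigma2.
have nN := normal_closure_normal S; have SN := @sub_normal_closure _ S.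
have [N1 NM NV NJ] := nN.
have Nm : normal_closure S `<=` braid_congruence 4 m.
  apply: normal_closure_min; first exact: braid_congruence_normal.
  move=> _ [[r /Rm rm <-]|[->|->]]; first exact/braid_congruence_incl.
    exact: sigma_expg_congruence.
  rewrite -DE.
  exact/braid_congruence_incl/rhobar1_congruence3/rhobar_full_twist.
(* The preimage of the closure in [B_3] is normal and contains the three-strand generators. *)
have N3 b : braid_congruence 3 m b -> normal_closure S (braid_incl b).
  rewrite B3; apply: (normal_closure_min (normal_subgroup_preimage _ nN)).
  move=> r [Rr|[->|->]]; apply: SN.
  - by left; exists r.
  - right; left; rewrite -braid_incl_sigma1; exact: inclX.
  - by right; right; exact: DE.
apply/seteqP; split=> // g gm.
have [Q [q qP]] := quotient_exists nN.
have q1P x : q x = 1 <-> normal_closure S x.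
  by rewrite -(gmulf1 (s := q)) qP divg1.
have s1m : q sigma1 ^+ m = 1.
  by rewrite -gmulfXn; apply/q1P; apply: SN; right; left.
have D1 : (q sigma1 * q sigma2) ^+ 6 = 1.
  by rewrite -gmulfM -gmulfXn; apply/q1P; apply: SN; right; right.
have [i [j [k [b qg]]]] := braid4_fiber_form m0 s1m D1 g.
have [_ CM CV _] := braid_congruence_normal 4 m.
(* The normal form differs from [g] by an element of the closure, which lies in B_4[m]. *)
have fbm : braid_congruence 4 m
    (fiber_x ^+ i * fiber_y ^+ j * fiber_c ^+ k * braid_incl b).
  by rewrite -(mulgVK g (_ * braid_incl b)); apply: CM gm; apply/Nm/qP.
have [mi mj mk] := fiber_congruence fbm.
have f1 := fiber_eq1 m0 s1m D1 mi mj mk.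
(* The fiber part is trivial in the quotient, hence in B_4[m]; cancelling it leaves [b], and the
   three-strand case applies. *)
have bm : braid_congruence 3 m b.
  set f := fiber_x ^+ i * _ * _ in fbm f1 *.
  apply/braid_congruence_incl; rewrite -(mulKg f (braid_incl b)).
  by apply: CM fbm; apply/CV/Nm/q1P.
by apply/q1P; rewrite qg gmulfM f1 mul1g; apply/q1P; exact: N3 bm.
Qed.
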